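(* Let $n\ge 0$ be an integer, and let $q,u_1,\ldots,u_{n+1}$ be indeterminates. Write $\bar{x}=x^{-1}$ and $\sigma(x)=x-x^{-1}$. Then the odd-order DASASM partition function satisfies, as an identity of rational functions, $$Z(u_1,\ldots,u_{n+1})=\frac{\sigma(q^2)^n}{\sigma(q)^{2n}\,\sigma(q^4)^{n^2}}\prod_{i=1}^n\frac{\sigma(u_i)\,\sigma(qu_i)\,\sigma(q\bar{u}_i)\,\sigma(q^2u_iu_{n+1})\,\sigma(q^2\bar{u}_i\bar{u}_{n+1})}{\sigma(u_i\bar{u}_{n+1})}\prod_{1\le i<j\le n}\left(\frac{\sigma(q^2u_iu_j)\,\sigma(q^2\bar{u}_i\bar{u}_j)}{\sigma(u_i\bar{u}_j)}\right)^2\times\bigl(\det M+\det M'\bigr),$$ where $M$ and $M'$ are the $(n+1)\times(n+1)$ matrices with entries, for $1\le i,j\le n+1$, $$M_{ij}=\begin{cases}\dfrac{q^2+\bar{q}^2+u_i^2+\bar{u}_j^2}{\sigma(q^2u_iu_j)\,\sigma(q^2\bar{u}_i\bar{u}_j)},&i\le n,\\[3mm]\dfrac{u_{n+1}-1}{u_j^2-1},&i=n+1,\end{cases}\qquad M'_{ij}=\begin{cases}\dfrac{q^2+\bar{q}^2+\bar{u}_i^2+u_j^2}{\sigma(q^2u_iu_j)\,\sigma(q^2\bar{u}_i\bar{u}_j)},&i\le n,\\[3mm]\dfrac{\bar{u}_{n+1}-1}{\bar{u}_j^2-1},&i=n+1.\end{cases}$$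
   Context: Notation: $\bar{x}=x^{-1}$ and $\sigma(x)=x-x^{-1}$. The parameter $q$ is fixed and suppressed from the notation. The graph $\mathcal{T}_n$ ($n\ge0$). Its vertices are: top vertices $(0,j)$ for $1\le j\le 2n+1$; vertices $(i,j)$ for $1\le i\le n$ and $i\le j\le 2n+2-i$; and a bottom vertex $(n+1,n+1)$. Vertex $(i,j)$ is drawn in row $i$ (rows numbered downward) and column $j$ (numbered rightward). Its edges are the horizontal edges between $(i,j)$ and $(i,j+1)$ for $1\le i\le n$, $i\le j\le 2n+1-i$, and the vertical edges between $(i-1,j)$ and $(i,j)$ for $1\le i\le n+1$, $i\le j\le 2n+2-i$. The vertices $(i,i)$ ($1\le i\le n$, degree 2, incident edges above and to the right) are left boundary vertices; $(i,2n+2-i)$ ($1\le i\le n$, degree 2, incident edges above and to the left) are right boundary vertices; $(i,j)$ with $1\le i\le n$, $i<j<2n+2-i$ (degree 4) are bulk vertices. A six-vertex configuration $C$ on $\mathcal{T}_n$ is an orientation of all edges of $\mathcal{T}_n$ such that each edge incident to a top vertex is directed upward (into the top vertex), and at each bulk vertex exactly two incident edges are directed in and two are directed out. $C_{ij}$ denotes the local configuration (orientations of the edges incident to $(i,j)$). Weights $W(c,u)$ of a local configuration $c$ with parameter $u$: - Bulk vertex: $W(c,u)=1$ if both horizontal edges point into the vertex (and both vertical edges out), or both horizontal edges point out (and both vertical edges in); $W(c,u)=\sigma(q^2u)/\sigma(q^4)$ if both vertical edges point up and both horizontal edges point right, or both vertical edges point down and both horizontal edges point left; $W(c,u)=\sigma(q^2\bar{u})/\sigma(q^4)$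 if both vertical edges point up and both horizontal edges point left, or both vertical edges point down and both horizontal edges point right. - Left boundary vertex: $W(c,u)=1$ if one of the two incident edges points in and the other out; $W(c,u)=\sigma(qu)/\sigma(q)$ if both point in or both point out. - Right boundary vertex: $W(c,u)=1$ if one of the two incident edges points in and the other out; $W(c,u)=\sigma(q\bar{u})/\sigma(q)$ if both point in or both point out. The odd-order DASASM partition function is $$Z(u_1,\ldots,u_{n+1})=\sum_{C}\prod_{i=1}^n W(C_{ii},u_i)\left(\prod_{j=i+1}^{2n+1-i}W(C_{ij},u_i\,u_{\min(j,2n+2-j)})\right)W(C_{i,2n+2-i},u_i),$$ summed over all six-vertex configurations $C$ on $\mathcal{T}_n$ (so $Z(u_1)=1$ for $n=0$). *)

(* Defs.v *)
From mathcomp Require Import all_boot all_order all_algebra.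
From mathcomp Require Import mpoly.
Set Implicit Arguments.
Unset Strict Implicit.
Unset Printing Implicit Defensive.
Import GRing.Theory.
Local Open Scope ring_scope.

(* The vertices (i, j) of the graph T_n lie in the box 0 <= i <= n + 1,
   0 <= j <= 2n + 1. *)
Definition box (n : nat) := ('I_n.+2 * 'I_(2 * n).+2)%type.

(* Only used for i <= n + 1 and j <= 2n + 1, where inord is the identity. *)
Definition pt (n i j : nat) : box n := (inord i, inord j).

(* The horizontal edge {(i, j), (i, j + 1)} is indexed by its left endpoint
   (i, j), the vertical edge {(i - 1, j), (i, j)} by its lower endpoint (i, j). *)
Definition hedges (n : nat) : {set box n} :=
  [set e : box n | [&& 1 <= e.1, e.1 <= n, e.1 <= e.2
                     & e.2 <= (2 * n).+1 - e.1]%N].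

Definition vedges (n : nat) : {set box n} :=
  [set e : box n | [&& 1 <= e.1, e.1 <= n.+1, e.1 <= e.2
                     & e.2 <= (2 * n).+2 - e.1]%N].

(* An orientation of all edges of T_n is encoded by the set of horizontal edges
   directed to the right and the set of vertical edges directed upward. *)
Definition arrows (n : nat) := ({set box n} * {set box n})%type.

Definition orientation (n : nat) (C : arrows n) : bool :=
  (C.1 \subset hedges n) && (C.2 \subset vedges n).

(* The edge to the left of (resp. to the right of, above, below) vertex (i, j)
   is directed into (i, j); meaningful only if that edge exists. *)
Definition inL (n : nat) (C : arrows n) (i j : nat) : bool := pt n i j.-1 \in C.1.
Definition inR (n : nat) (C : arrows n) (i j : nat) : bool := pt n i j \notin C.1.
Definition inA (n : nat) (C : arrows n) (i j : nat) : bool := pt n i j \notin C.2.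
Definition inB (n : nat) (C : arrows n) (i j : nat) : bool := pt n i.+1 j \in C.2.

Definition bulk (n i j : nat) : bool :=
  [&& 1 <= i, i <= n, i < j & j < (2 * n).+2 - i]%N.

(* At a bulk vertex, which has degree 4, exactly two edges are directed in (so
   exactly two out). *)
Definition six_vertex (n : nat) (C : arrows n) : bool :=
  [&& orientation C,
      [forall j : 'I_(2 * n).+2, (1 <= j)%N ==> (pt n 1 j \in C.2)]
    & [forall v : box n, bulk n v.1 v.2 ==>
         (inL C v.1 v.2 + inR C v.1 v.2 + inA C v.1 v.2 + inB C v.1 v.2 == 2)%N]].

Section Weights.
Variable K : fieldType.

Definition sigma (x : K) : K := x - x^-1.

(* l, r, a, b : the edge to the left, to the right, above, below is directed
   into the vertex. *)
Definition Wbulk (q : K) (l r a b : bool) (u : K) : K :=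
  match l, r, a, b with
  | true, true, false, false | false, false, true, true => 1
  (* up and right; down and left *)
  | true, false, false, true | false, true, true, false =>
      sigma (q ^+ 2 * u) / sigma (q ^+ 4)
  (* up and left; down and right *)
  | false, true, false, true | true, false, true, false =>
      sigma (q ^+ 2 * u^-1) / sigma (q ^+ 4)
  (* excluded by the six-vertex condition *)
  | _, _, _, _ => 0
  end.

Definition Wleft (q : K) (a r : bool) (u : K) : K :=
  if a == r then sigma (q * u) / sigma q else 1.

Definition Wright (q : K) (a l : bool) (u : K) : K :=
  if a == l then sigma (q * u^-1) / sigma q else 1.

(* Parameters are indexed from 1: only u 1, ..., u n.+1 are used. *)
Definition Z (n : nat) (q : K) (u : nat -> K) : K :=
  \sum_(C : arrows n | six_vertex C)
    \prod_(1 <= i < n.+1)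
      (let i' := ((2 * n).+2 - i)%N in
       Wleft q (inA C i i) (inR C i i) (u i)
       * (\prod_(i.+1 <= j < i')
            Wbulk q (inL C i j) (inR C i j) (inA C i j) (inB C i j)
              (u i * u (minn j ((2 * n).+2 - j))))
       * Wright q (inA C i i') (inL C i i') (u i)).

(* Row and column k of the matrices below carry the parameter u k.+1. *)
Definition matM (n : nat) (q : K) (u : nat -> K) : 'M[K]_n.+1 :=
  \matrix_(i < n.+1, j < n.+1)
    if (i < n)%N then
      (q ^+ 2 + q^-1 ^+ 2 + u i.+1 ^+ 2 + (u j.+1)^-1 ^+ 2)
      / (sigma (q ^+ 2 * u i.+1 * u j.+1)
         * sigma (q ^+ 2 * (u i.+1)^-1 * (u j.+1)^-1))
    else (u n.+1 - 1) / (u j.+1 ^+ 2 - 1).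

Definition matM' (n : nat) (q : K) (u : nat -> K) : 'M[K]_n.+1 :=
  \matrix_(i < n.+1, j < n.+1)
    if (i < n)%N then
      (q ^+ 2 + q^-1 ^+ 2 + (u i.+1)^-1 ^+ 2 + u j.+1 ^+ 2)
      / (sigma (q ^+ 2 * u i.+1 * u j.+1)
         * sigma (q ^+ 2 * (u i.+1)^-1 * (u j.+1)^-1))
    else ((u n.+1)^-1 - 1) / ((u j.+1)^-1 ^+ 2 - 1).

End Weights.

(* The field F(q, u_1, ..., u_{n+1}): variable 0 is q and variable k is u_k for
   1 <= k <= n + 1. *)
Definition ratfun (F : fieldType) (n : nat) : fieldType :=
  {fraction {mpoly F[n.+2]}}.

Definition qvar (F : fieldType) (n : nat) : ratfun F n :=
  tofrac ('X_ord0 : {mpoly F[n.+2]}).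

Definition uvar (F : fieldType) (n : nat) (k : nat) : ratfun F n :=
  tofrac ('X_(inord k) : {mpoly F[n.+2]}).

(* Main.v *)
Require Import Defs.
From mathcomp Require Import all_boot all_order all_fingroup all_algebra.
From mathcomp Require Import mpoly.
From mathcomp Require Import zify ring.
From Stdlib Require Import FunctionalExtensionality.
Set Implicit Arguments.
Unset Strict Implicit.
Unset Printing Implicit Defensive.
Import GRing.Theory.
Local Open Scope ring_scope.

(* Cut the lattice between its rows: [Z] becomes the value, at the state with
   all edges up, of a product of row operators built from six-vertex crossings
   and two boundary factors.  The Yang-Baxter equation and the two reflection
   equations make [Z] symmetric in u_1, ..., u_n.  When u_i u_{n+1} = q^2, the
   central column turns into path i without crossing it, and pulling the
   resulting line through the other paths by the same equations leaves the
   partition function of the remaining parameters with u_i at the centre.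

   Let x = u_{n+1}.  After multiplication by \prod_i sigma (u_i / x), both sides
   are Laurent polynomials in x with exponents between -2n and 2n, so it is
   enough to compare them at 4n + 1 points.  Both vanish at x = u_i and
   x = - u_i.  At x = q^2 / u_i and x = - q^2 / u_i the recursion applies
   (for the second, after the substitution u_i -> - u_i, under which both sides
   are invariant), while in the expansion of the determinants along the last
   column a single cofactor survives, itself a determinant of the same kind of
   order n.  One last point, x = 1 / (q^2 u_1), is reached by inverting all the
   parameters, which exchanges the two determinants. *)

(** What singles out $u_i u_{n+1}=q^2$: of the three bulk weights one becomes $\sigma(1)=0$ and the
    other two become 1, so that in terms of strand positions the crossing is the identity operator.
    The $4n$ points $\pm u_i$, $\pm q^2/u_i$ are one short of what the degree demands, and neither
    permutations nor sign changes of the parameters produce a new one; inversion does, hence the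
    left-right reflection and the crossing symmetry. On the determinant side the obstacle is the
    last row, whose entries have poles at $x=\pm1$ that cancel only in $\det M+\det M'$. The two
    determinants are therefore treated as one Laurent polynomial, and split again only at points
    where the poles are harmless. All of this takes place over an arbitrary field of characteristic
    other than 2, under explicit inequalities between the parameters; the rational function field
    enters only at the end, where the inequalities are checked by specialization. *)

(* Orientations of the vertical strands met by a horizontal cut, numbered from
   the left, [true] meaning up.  There are infinitely many strands, of which
   only finitely many matter, so that operators need no size index. *)
Definition state := nat -> bool.

Definition upd (s : state) (j : nat) (b : bool) : state :=
  fun k => if k == j then b else s k.

Definition del (p : nat) (s : state) : state :=
  fun k => if (k < p)%N then s k else s k.+2.

Ltac state_eq :=
  apply: functional_extensionality => k; rewrite /upd /del /=;
  repeat (case: eqP => ?; try subst); try (by []); try lia; try congruence.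

Lemma upd_upd (s : state) j b c : upd (upd s j b) j c = upd s j c.
Proof. by state_eq. Qed.

Lemma updC (s : state) i j b c : i != j ->
  upd (upd s i b) j c = upd (upd s j c) i b.
Proof. by move=> /eqP neq; state_eq. Qed.

Lemma upd_id (s : state) j : upd s j (s j) = s.
Proof. by state_eq. Qed.

Lemma updE (s : state) j b : upd s j b j = b.
Proof. by rewrite /upd eqxx. Qed.

Lemma updN (s : state) i j b : i != j -> upd s j b i = s i.
Proof. by rewrite /upd => /negbTE ->. Qed.

Lemma upd1 (s : state) j b : upd s j.+1 b j = s j.
Proof. by rewrite updN ?ltn_eqF. Qed.

Lemma upd2 (s : state) j b : upd s j.+2 b j = s j.
Proof. by rewrite updN ?ltn_eqF. Qed.

(** * Laurent polynomials and interpolation *)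

Section Laurent.
Variable K : fieldType.
Implicit Types (F G : K -> K) (d N : nat).

(* Laurent polynomials with exponents between [- d] and [N - d]. *)
Definition laurent d N F := exists p : {poly K},
  (size p <= N.+1)%N /\ forall x, x != 0 -> x ^+ d * F x = p.[x].

Lemma eq_laurent d N F G : (forall x, x != 0 -> F x = G x) ->
  laurent d N F -> laurent d N G.
Proof. by move=> eqFG [p [sp pE]]; exists p; split=> // x x0; rewrite -eqFG // pE. Qed.

Lemma laurentC a : laurent 0 0 (fun=> a).
Proof.
by exists a%:P; split=> [|x _]; [exact: size_polyC_leq1 | rewrite hornerC mul1r].
Qed.

Lemma laurentM d1 N1 d2 N2 F G : laurent d1 N1 F -> laurent d2 N2 G ->
  laurent (d1 + d2) (N1 + N2) (fun x => F x * G x).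
Proof.
move=> [p [sp pE]] [r [sr rE]]; exists (p * r); split=> [|x x0].
  apply: leq_trans (size_polyMleq _ _) _.
  by rewrite -subn1 leq_subLR add1n -addnS -addSn leq_add.
by rewrite hornerM -pE // -rE // exprD mulrACA.
Qed.

Lemma laurentD d N F G : laurent d N F -> laurent d N G ->
  laurent d N (fun x => F x + G x).
Proof.
move=> [p [sp pE]] [r [sr rE]]; exists (p + r); split=> [|x x0].
  by apply: leq_trans (size_polyD _ _) _; rewrite geq_max sp.
by rewrite hornerD -pE // -rE // mulrDr.
Qed.

Lemma laurent_weaken d N d' N' F : laurent d N F -> (d <= d')%N ->
  (N + d' <= N' + d)%N -> laurent d' N' F.
Proof.
move=> [p [sp pE]] led leN; exists (p * 'X^(d' - d)); split=> [|x x0].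
  apply: leq_trans (size_polyMleq _ _) _; rewrite size_polyXn addnS /=.
  by apply: leq_trans (leq_add sp (leqnn _)) _; lia.
by rewrite hornerM hornerXn -pE // -{1}(subnKC led) exprD mulrAC.
Qed.

Lemma laurentZ d N a F : laurent d N F -> laurent d N (fun x => a * F x).
Proof. exact: (laurentM (laurentC a)). Qed.

Lemma laurent_sum I (r : seq I) (P : pred I) d N (F : I -> K -> K) :
  (forall i, laurent d N (F i)) ->
  laurent d N (fun x => \sum_(i <- r | P i) F i x).
Proof.
move=> lF; elim: r => [|i r IH].
  by exists 0; split=> [|x _]; rewrite ?size_poly0 // big_nil mulr0 horner0.
case Pi: (P i); last by apply: eq_laurent IH => x _; rewrite big_cons Pi.
by apply: eq_laurent (laurentD (lF i) IH) => x _; rewrite big_cons Pi.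
Qed.

Lemma laurent_prod I (r : seq I) (P : pred I) d N (F : I -> K -> K) :
  (forall i, laurent d N (F i)) ->
  laurent (count P r * d) (count P r * N) (fun x => \prod_(i <- r | P i) F i x).
Proof.
move=> lF; elim: r => [|i r IH].
  by apply: eq_laurent (laurentC 1) => x _; rewrite big_nil.
case Pi: (P i); rewrite /= Pi ?mulSn.
  by apply: eq_laurent (laurentM (lF i) IH) => x _; rewrite big_cons Pi.
by apply: eq_laurent IH => x _; rewrite big_cons Pi.
Qed.

Lemma laurentX : laurent 0 1 id.
Proof. by exists 'X; split=> [|x _]; rewrite ?size_polyX // hornerX mul1r. Qed.

Lemma laurentV : laurent 1 0 GRing.inv.
Proof.
by exists 1; split=> [|x x0]; rewrite ?size_poly1 // hornerC expr1 divff.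
Qed.

Lemma laurent_sigma a : laurent 1 2 (fun x => sigma (a * x)).
Proof.
have l1 : laurent 1 2 (fun x => a * x).
  by apply: laurent_weaken (laurentZ a laurentX) _ _.
have l2 : laurent 1 2 (fun x => - a^-1 * x^-1).
  by apply: laurent_weaken (laurentZ (- a^-1) laurentV) _ _.
by apply: eq_laurent (laurentD l1 l2) => x _; rewrite /sigma invfM mulNr.
Qed.

Lemma laurent_sigmaV a : laurent 1 2 (fun x => sigma (a / x)).
Proof.
apply: eq_laurent (laurentZ (-1) (laurent_sigma a^-1)) => x _.
by rewrite /sigma !invfM !invrK; ring.
Qed.

(** Multiplied by [x ^+ d], the difference becomes a polynomial of degree at most [N] with more than
    [N] roots. *)
Lemma laurent_eq d N F G (rs : seq K) : laurent d N F -> laurent d N G ->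
  uniq rs -> 0 \notin rs -> (N < size rs)%N -> {in rs, F =1 G} ->
  forall x, x != 0 -> F x = G x.
Proof.
move=> [p [sp pE]] [r [sr rE]] uniq_rs rs0 lt_N eqFG x x0.
have pr : p - r = 0.
  apply/eqP; apply: contraLR lt_N => pr0; rewrite -leqNgt.
  rewrite -ltnS; apply: leq_trans (max_poly_roots pr0 _ uniq_rs) _.
    apply/allP => y yrs; have y0 : y != 0 by apply: contraNneq rs0 => <-.
    by rewrite rootE hornerD hornerN -pE // -rE // eqFG // subrr.
  by apply: leq_trans (size_polyD _ _) _; rewrite size_polyN geq_max sp.
have /mulfI : x ^+ d != 0 by rewrite expf_neq0.
by apply; rewrite pE // rE //; move/eqP: pr; rewrite subr_eq0 => /eqP ->.
Qed.

End Laurent.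

Section Partition.
Variables (K : fieldType) (q : K).

(** * Crossings, boundary factors and sweeps as operators on functions of states *)

Section Operators.
Implicit Types (f g : state -> K) (s : state) (u v w z : K).

Definition weight_a u : K := sigma (q ^+ 2 * u) / sigma (q ^+ 4).
Definition weight_b u : K := sigma (q ^+ 2 * u^-1) / sigma (q ^+ 4).
Definition weight_bounce u : K := sigma (q * u^-1) / sigma q.

(* A line in position [j] crosses the strand in position [j.+1] and takes its
   place; in terms of positions the weight 1 of the two configurations with
   opposite horizontal edges is the diagonal term. *)
Definition cross j u f : state -> K := fun s =>
  if s j == s j.+1 then weight_a u * f s
  else f s + weight_b u * f (upd (upd s j (s j.+1)) j.+1 (s j)).

(* The right boundary vertex. *)
Definition bounce j u f : state -> K := fun s =>
  f s + weight_bounce u * f (upd s j (~~ s j)).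

(* Opens two strands joined by a turn that preserves the orientation along the
   line. *)
Definition cup p f : state -> K := fun s =>
  if s p == s p.+1 then 0 else f (del p s).

(* The left boundary vertex: sigma (q u) = sigma (q (u^-1)^-1). *)
Definition corner u f := bounce 0 u^-1 (cup 0 f).

Lemma cross_comm i j u v f : (i.+1 < j)%N ->
  cross i u (cross j v f) = cross j v (cross i u f).
Proof.
move=> ltij; apply: functional_extensionality => s; rewrite /cross.
rewrite !(@updN _ j) ?(@updN _ j.+1) ?(@updN _ i) ?(@updN _ i.+1); try lia.
case: eqP => _; case: eqP => _ //; first by rewrite mulrCA.
  by rewrite mulrDr mulrCA.
  by rewrite mulrDr mulrCA.
have -> : upd (upd (upd (upd s i (s i.+1)) i.+1 (s i)) j (s j.+1)) j.+1 (s j)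
  = upd (upd (upd (upd s j (s j.+1)) j.+1 (s j)) i (s i.+1)) i.+1 (s i).
  by state_eq.
by ring.
Qed.

Lemma cross_bounce i j u v f : (i.+1 < j)%N || (j < i)%N ->
  cross i u (bounce j v f) = bounce j v (cross i u f).
Proof.
move=> ltij; apply: functional_extensionality => s; rewrite /cross /bounce.
rewrite !(@updN _ j) ?(@updN _ i) ?(@updN _ i.+1); try lia.
case: eqP => _; first by rewrite mulrDr mulrCA.
have -> : upd (upd (upd s i (s i.+1)) i.+1 (s i)) j (~~ s j)
  = upd (upd (upd s j (~~ s j)) i (s i.+1)) i.+1 (s i) by state_eq.
by ring.
Qed.

Lemma bounce_comm i j u v f : i != j ->
  bounce i u (bounce j v f) = bounce j v (bounce i u f).
Proof.
move=> neq; apply: functional_extensionality => s; rewrite /bounce.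
rewrite !(@updN _ j) ?(@updN _ i) // 1?eq_sym // updC //.
by ring.
Qed.

Definition R12 (a b : K) (F : bool -> bool -> bool -> K) (x y z : bool) :=
  if x == y then a * F x y z else F x y z + b * F y x z.
Definition R23 (a b : K) (F : bool -> bool -> bool -> K) (x y z : bool) :=
  if y == z then a * F x y z else F x y z + b * F x z y.

Definition loc3 j f s (x y z : bool) := f (upd (upd (upd s j x) j.+1 y) j.+2 z).

Lemma loc3_R12 j u f s :
  loc3 j (cross j u f) s = R12 (weight_a u) (weight_b u) (loc3 j f s).
Proof.
do 3![apply: functional_extensionality => ?]; rewrite /loc3 /cross /R12.
rewrite !(upd1, upd2, updE).
case: eqP => // _; congr (_ + _ * f _).
by state_eq.
Qed.

Lemma loc3_R23 j u f s :
  loc3 j (cross j.+1 u f) s = R23 (weight_a u) (weight_b u) (loc3 j f s).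
Proof.
do 3![apply: functional_extensionality => ?]; rewrite /loc3 /cross /R23.
rewrite !(upd1, upd2, updE).
case: eqP => // _; congr (_ + _ * f _).
by state_eq.
Qed.

Lemma loc3_ext j f g : (forall s, loc3 j f s = loc3 j g s) -> f = g.
Proof.
move=> eqfg; apply: functional_extensionality => s.
have /(congr1 (fun F => F (s j) (s j.+1) (s j.+2))) := eqfg s.
by rewrite /loc3 !upd_id.
Qed.

(** [cup] vanishes on equal orientations, so exactly one of the two terms of [bounce] survives. *)
Lemma cornerE u f s :
  corner u f s = (if s 0 == s 1%N then weight_bounce u^-1 else 1) * f (del 0 s).
Proof.
rewrite /corner /bounce /cup /= updE updN //.
have -> : del 0 (upd s 0 (~~ s 0)) = del 0 s by state_eq.
by case: (s 0) (s 1%N) => -[] /=; rewrite ?add0r ?mulr0 ?addr0 ?mul1r.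
Qed.

(* The line in position [p] crosses the next [size l] strands; the head of [l]
   belongs to the first, i.e. leftmost, crossing. *)
Fixpoint sweep p (l : seq K) f : state -> K :=
  if l is u :: l' then sweep p.+1 l' (cross p u f) else f.

Lemma sweep_cat p l1 l2 f : sweep p (l1 ++ l2) f = sweep (p + size l1) l2 (sweep p l1 f).
Proof.
elim: l1 p f => [|u l1 IH] p f /=; first by rewrite addn0.
by rewrite IH addSnnS.
Qed.

Lemma cross_sweep i p l u f : (i.+1 < p)%N || (p + size l < i)%N ->
  cross i u (sweep p l f) = sweep p l (cross i u f).
Proof.
elim: l p f => //= v l IH p f lt_ip; rewrite IH; last lia.
congr sweep; case/orP: lt_ip => lt_ip.
  by rewrite cross_comm.
by rewrite -cross_comm //; lia.
Qed.

Lemma bounce_sweep i p l u f : (i < p)%N || (p + size l < i)%N ->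
  bounce i u (sweep p l f) = sweep p l (bounce i u f).
Proof.
elim: l p f => //= v l IH p f lt_ip; rewrite IH; last lia.
by congr sweep; rewrite cross_bounce //; lia.
Qed.

End Operators.

(** * Rows as operators, and the partition function as their product *)

Section TopSum.
Implicit Types (f g : state -> K) (s : state) (a b u v w x z : K) (us l : seq K).

Lemma corner_cross j u v f : corner u (cross j v f) = cross j.+2 v (corner u f).
Proof.
apply: functional_extensionality => s; rewrite cornerE /cross !cornerE /=.
have -> : del 0 (upd (upd s j.+2 (s j.+3)) j.+3 (s j.+2))
  = upd (upd (del 0 s) j (del 0 s j.+1)) j.+1 (del 0 s j) by state_eq.
rewrite -/(del 0 s j) -/(del 0 s j.+1) /del /=.
by case: (_ == s j.+3); rewrite ?mulrDr mulrCA.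
Qed.

Lemma corner_bounce j u v f : corner u (bounce j v f) = bounce j.+2 v (corner u f).
Proof.
apply: functional_extensionality => s; rewrite cornerE /bounce !cornerE /=.
have -> : del 0 (upd s j.+2 (~~ s j.+2)) = upd (del 0 s) j (~~ del 0 s j).
  by state_eq.
by rewrite mulrDr mulrCA.
Qed.

Lemma corner_sweep p l u f : corner u (sweep p l f) = sweep p.+2 l (corner u f).
Proof. by elim: l p f => //= v l IH p f; rewrite IH corner_cross. Qed.

(** The corner adds position 0, the edge above the left boundary vertex, and position 1, the
    horizontal edge; the latter moves one position to the right at each crossing and ends below the
    edge of the right boundary vertex. *)
Definition row_op u l f := bounce (size l).+1 u (sweep 1 l (corner u f)).

(** The column parameters $u_{\min(j,2n+2-j)}$ that a row meets from left to right. *)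
Definition pal us x := us ++ x :: rev us.

Arguments pal : simpl never.

(* The sum over the rows with parameters [us] and central parameter [x], as a
   function of the orientations of the topmost vertical edges; the value 1 for
   the empty list leaves the bottom edge free. *)
Fixpoint topsum us x : state -> K :=
  if us is u :: us' then row_op u (map ( *%R u) (pal us' x)) (topsum us' x)
  else fun=> 1.

Lemma topsum_cons u us x :
  topsum (u :: us) x = row_op u (map ( *%R u) (pal us x)) (topsum us x).
Proof. by []. Qed.

Lemma size_pal us x : size (pal us x) = (size us).*2.+1.
Proof. by rewrite size_cat /= size_rev; lia. Qed.

(** Operators on disjoint strands commute. This brings one crossing of the lines [u] and [v] next to
    the two corners and the other between the two bounces, the shape to which the reflection
    equations apply, with [braid_pair] for the part in between. *)
Lemma row_op_row_op u v m f : (0 < size m)%N ->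
  let M := (size m).+2 in
  row_op u (map ( *%R u) (v :: m ++ [:: v])) (row_op v (map ( *%R v) m) f)
  = bounce M.+1 u (cross M (u * v) (bounce M.+1 v
      (sweep 2 (map ( *%R u) m) (sweep 3 (map ( *%R v) m)
         (cross 1 (u * v) (corner u (corner v f))))))).
Proof.
move=> m0 M; rewrite /row_op /= !size_map size_cat addn1 map_cat sweep_cat size_map /=.
rewrite add2n corner_bounce corner_sweep; congr (bounce _ _ (cross _ _ _)).
by rewrite cross_bounce 1?bounce_sweep ?cross_sweep //; rewrite ?size_map; lia.
Qed.

Lemma pal_cons u us x : pal (u :: us) x = u :: pal us x ++ [:: u].
Proof. by rewrite /pal /= rev_cons -cats1 -catA. Qed.

End TopSum.

Section Linearity.
Implicit Types (f g : state -> K) (s : state) (a b c u v w x y z : K) (us vs l : seq K).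

Lemma sweep_sweep p1 l1 p2 l2 f : (p1 + size l1 < p2)%N ->
  sweep p1 l1 (sweep p2 l2 f) = sweep p2 l2 (sweep p1 l1 f).
Proof.
elim: l1 p1 f => //= u l1 IH p1 f lt_p; rewrite cross_sweep ?IH //; lia.
Qed.

Definition scale c f : state -> K := fun s => c * f s.

Lemma cross_scale j u c f : cross j u (scale c f) = scale c (cross j u f).
Proof.
apply: functional_extensionality => s; rewrite /cross /scale.
by case: eqP => _; ring.
Qed.

Lemma bounce_scale j u c f : bounce j u (scale c f) = scale c (bounce j u f).
Proof.
by apply: functional_extensionality => s; rewrite /bounce /scale; ring.
Qed.

Lemma corner_scale u c f : corner u (scale c f) = scale c (corner u f).
Proof.
by apply: functional_extensionality => s; rewrite cornerE /scale cornerE mulrCA.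
Qed.

Lemma sweep_scale p l c f : sweep p l (scale c f) = scale c (sweep p l f).
Proof. by elim: l p f => //= u l IH p f; rewrite cross_scale IH. Qed.

Definition all_up : state := fun=> true.

Lemma sweep_all_up p l f : sweep p l f all_up = \prod_(a <- l) weight_a a * f all_up.
Proof.
elim: l p f => [|u l IH] p f /=; first by rewrite big_nil mul1r.
by rewrite IH big_cons /cross /= mulrCA mulrA.
Qed.

End Linearity.

(** * Sign change and inversion of the parameters *)

Section Symmetries.
Implicit Types (f g : state -> K) (s : state) (a b c u v w x y z : K) (us vs l : seq K).

Lemma sigmaN w : sigma (- w) = - sigma w.
Proof. by rewrite /sigma invrN opprD. Qed.

(* Changing the sign of the parameter of a line is a gauge transformation: the
   signs cancel along the line, except at its two ends. *)
Definition flipsign j f : state -> K := fun s => (-1) ^+ s j * f s.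

Lemma flipsignK j f : flipsign j (flipsign j f) = f.
Proof. by apply: functional_extensionality => s; rewrite /flipsign signrMK. Qed.

Lemma flipsign_scale j c f : flipsign j (scale c f) = scale c (flipsign j f).
Proof. by apply: functional_extensionality => s; rewrite /flipsign /scale mulrCA. Qed.

Lemma flipsignC i j f : flipsign i (flipsign j f) = flipsign j (flipsign i f).
Proof. by apply: functional_extensionality => s; rewrite /flipsign mulrCA. Qed.

Lemma scaleA a b f : scale a (scale b f) = scale (a * b) f.
Proof. by apply: functional_extensionality => s; rewrite /scale mulrA. Qed.

Lemma crossN j u f :
  cross j (- u) f = scale (-1) (flipsign j.+1 (cross j u (flipsign j f))).
Proof.
apply: functional_extensionality => s.
rewrite /scale /flipsign /cross /weight_a /weight_b invrN !mulrN !sigmaN upd1 updE.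
by case: (s j) (s j.+1) => -[] /=; ring.
Qed.

Lemma bounceN j u f : bounce j (- u) f = flipsign j (bounce j u (flipsign j f)).
Proof.
apply: functional_extensionality => s; rewrite /flipsign /bounce /weight_bounce.
by rewrite invrN mulrN sigmaN updE; case: (s j) => /=; ring.
Qed.

Lemma cornerN u f :
  corner (- u) f = scale (-1) (flipsign 0 (flipsign 1 (corner u f))).
Proof.
apply: functional_extensionality => s; rewrite /scale /flipsign !cornerE /weight_bounce.
by rewrite !invrN mulrN sigmaN; case: (s 0) (s 1%N) => -[] /=; ring.
Qed.

Lemma flipsign_cross i j u f : (i < j)%N ->
  flipsign i (cross j u f) = cross j u (flipsign i f).
Proof.
move=> ltij; apply: functional_extensionality => s.
have [ni ni'] : i != j /\ i != j.+1 by lia.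
rewrite /flipsign /cross (updN _ _ ni') (updN _ _ ni).
by case: (s j == s j.+1); ring.
Qed.

Lemma flipsign_sweep i p l f : (i < p)%N ->
  flipsign i (sweep p l f) = sweep p l (flipsign i f).
Proof.
by elim: l p f => //= u l IH p f lt_ip; rewrite IH 1?flipsign_cross // ltnW.
Qed.

Lemma flipsign_bounce i j u f : (i < j)%N ->
  flipsign i (bounce j u f) = bounce j u (flipsign i f).
Proof.
move=> ltij; apply: functional_extensionality => s.
by rewrite /flipsign /bounce !updN ?ltn_eqF //; ring.
Qed.

Lemma sweep_opp p l f : sweep p (map -%R l) f
  = scale ((-1) ^+ size l) (flipsign (p + size l) (sweep p l (flipsign p f))).
Proof.
elim: l p f => [|u l IH] p f /=.
  by rewrite addn0 flipsignK; apply: functional_extensionality => s; rewrite /scale mul1r.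
rewrite IH crossN flipsign_scale flipsignK sweep_scale flipsign_scale scaleA.
by rewrite addSnnS -exprSr.
Qed.

(** The corner and the two upward ends of the line contribute three signs; the odd number of
    crossings supplies the fourth. *)
Lemma row_op_opp u l f : odd (size l) ->
  row_op (- u) (map -%R l) f all_up = row_op u l f all_up.
Proof.
move=> odd_l.
have cupN : flipsign 1 (corner (- u) f) = scale (-1) (flipsign 0 (corner u f)).
  by rewrite cornerN flipsign_scale [flipsign 0 _]flipsignC flipsignK.
rewrite /row_op size_map sweep_opp cupN sweep_scale -flipsign_sweep //.
rewrite flipsign_scale scaleA add1n.
rewrite bounceN flipsign_scale flipsignK bounce_scale -flipsign_bounce //.
rewrite flipsign_scale /scale /flipsign /all_up -signr_odd odd_l /=.
by ring.
Qed.

Lemma topsum_all_upN u us x : topsum (- u :: us) x all_up = topsum (u :: us) x all_up.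
Proof.
rewrite !topsum_cons -(@row_op_opp u) ?size_map ?size_pal ?oddS ?odd_double //.
by rewrite -map_comp; congr (row_op _ _ _ _); apply: eq_map => v; rewrite /= mulNr.
Qed.

Ltac del_eq p :=
  apply: functional_extensionality; let k := fresh "k" in intro k;
  rewrite /del /upd; case: (ltngtP k p) => [?|?|->]; repeat case: ifP => ?;
  solve [by [] | congruence | lia].

(* Crossing symmetry: a turn slides over a strand at the cost of inverting the
   parameter of the crossing. *)
Lemma cross_cup p u f : cross p.+1 u (cup p f) = cross p u^-1 (cup p.+1 f).
Proof.
apply: functional_extensionality => s; rewrite /cross /cup /weight_a /weight_b invrK.
have -> : upd (upd s p (s p.+1)) p.+1 (s p) p.+2 = s p.+2.
  by rewrite !updN ?gtn_eqF.
rewrite !(upd1, upd2, updE).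
have eq_del1 : s p = s p.+2 -> del p s = del p.+1 s by move=> ?; del_eq p.
have eq_del2 : s p.+1 = s p.+2 ->
    del p.+1 (upd (upd s p (s p.+1)) p.+1 (s p)) = del p s.
  by move=> ?; del_eq p.
have eq_del3 : s p = s p.+1 ->
    del p (upd (upd s p.+1 (s p.+2)) p.+2 (s p.+1)) = del p.+1 s.
  by move=> ?; del_eq p.
move: eq_del1 eq_del2 eq_del3; case: (s p) (s p.+1) (s p.+2) => -[] [] /= e1 e2 e3;
  try rewrite (e1 erefl); try rewrite (e2 erefl); try rewrite (e3 erefl); ring.
Qed.

(* As [sweep], with the crossings performed from right to left. *)
Fixpoint sweepr p l f : state -> K :=
  if l is u :: l' then cross p u (sweepr p.+1 l' f) else f.

Lemma sweepr_rcons p l u f : sweepr p (rcons l u) f = sweepr p l (cross (p + size l) u f).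
Proof.
by elim: l p => [|v l IH] p /=; rewrite ?addn0 // IH addSnnS.
Qed.

Lemma sweep_cup p l f :
  sweep p.+1 l (cup p f) = sweepr p (map GRing.inv l) (cup (p + size l) f).
Proof.
elim: l p => [|u l IH] p /=; first by rewrite addn0.
by rewrite cross_cup -cross_sweep ?ltnSn // IH addSnnS.
Qed.

Ltac index_eq :=
  apply: functional_extensionality; let k := fresh "k" in intro k;
  rewrite /del /upd; repeat case: ifP => ?;
  solve [by [] | lia | congr (_ _); lia].

Definition mirror N f : state -> K :=
  fun s => f (fun k => if (k <= N)%N then s (N - k)%N else s k).

Lemma mirror_cross N j u f : (j < N)%N ->
  mirror N (cross j u f) = cross (N - j.+1) u (mirror N f).
Proof.
move=> ltjN; apply: functional_extensionality => s; rewrite /mirror /cross.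
rewrite ltnW // ltjN -subSn // subSS eq_sym; case: eqP => // _.
congr (_ + _ * f _).
by index_eq.
Qed.

Lemma mirror_bounce N j u f : (j <= N)%N ->
  mirror N (bounce j u f) = bounce (N - j) u (mirror N f).
Proof.
move=> lejN; apply: functional_extensionality => s; rewrite /mirror /bounce.
rewrite lejN; congr (_ + _ * f _).
by index_eq.
Qed.

Lemma mirror_cup N j f : (j <= N.+1)%N ->
  mirror N.+2 (cup j f) = cup (N.+1 - j) (mirror N f).
Proof.
move=> lejN; apply: functional_extensionality => s; rewrite /mirror /cup.
rewrite ltnS lejN leqW // subSS -subSn // eq_sym; case: eqP => // _; congr f.
by index_eq.
Qed.

Lemma mirror_sweep N p l f : (p + size l <= N)%N ->
  mirror N (sweep p l f) = sweepr (N - (p + size l)) (rev l) (mirror N f).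
Proof.
elim: l p f => [|u l IH] p f //= le_pN.
rewrite rev_cons sweepr_rcons IH ?addSnnS // mirror_cross; last by lia.
by rewrite size_rev; congr (sweepr _ _ (cross _ _ _)); lia.
Qed.

(** Reflection exchanges the two boundary vertices, whose weights differ by inverting the parameter.
    The turn, now at the right end, slides back to the left by crossing symmetry, which inverts the
    parameter of every crossing. *)
Lemma row_op_mirror N u l f : size l = N.+1 ->
  mirror N.+2 (row_op u l f) = row_op u^-1 (map GRing.inv (rev l)) (mirror N f).
Proof.
move=> sl; rewrite /row_op size_map size_rev sl mirror_bounce // subnn.
rewrite /corner -!bounce_sweep // mirror_bounce // subn0 mirror_sweep ?add1n ?sl // subnn.
rewrite mirror_cup // sweep_cup size_map size_rev sl subn0 add0n.
rewrite -map_comp map_id_in => [|v _]; last by rewrite /= invrK.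
by rewrite invrK bounce_comm.
Qed.

Lemma topsum_inv us x :
  topsum (map GRing.inv us) x^-1 = mirror (size us).*2 (topsum us x).
Proof.
elim: us => // u us IH.
rewrite map_cons !topsum_cons (@row_op_mirror (size us).*2) ?size_map ?size_pal // IH.
have pal_rev : rev (pal us x) = pal us x.
  by rewrite /pal rev_cat rev_cons revK cat_rcons.
have pal_inv : pal (map GRing.inv us) x^-1 = map GRing.inv (pal us x).
  by rewrite /pal map_cat /= map_rev.
rewrite -map_rev pal_rev pal_inv -!map_comp; congr (row_op _ _ _).
by apply: eq_map => v /=; rewrite invfM.
Qed.

Lemma topsum_all_up_inv us x :
  topsum (map GRing.inv us) x^-1 all_up = topsum us x all_up.
Proof.
rewrite topsum_inv /mirror; congr topsum.
by apply: functional_extensionality => k; case: ifP.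
Qed.

End Symmetries.

(** * From the sum over orientations to the row operators *)

Section Bridge.

(* [(true, (i, j))] is the vertical edge whose lower end is (i, j) and
   [(false, (i, j))] the horizontal edge whose left end is (i, j). *)
Definition edge := (bool * (nat * nat))%type.
Definition config := edge -> bool.
Definition eupd (c : config) (e : edge) (b : bool) : config :=
  fun e' => if e' == e then b else c e'.

Implicit Types (c : config) (e : edge) (es : seq edge) (f g : state -> K).

Lemma eupdN c e e' b : e' != e -> eupd c e b e' = c e'.
Proof. by rewrite /eupd => /negbTE ->. Qed.

Lemma eupdE c e b : eupd c e b e = b.
Proof. by rewrite /eupd eqxx. Qed.

Fixpoint esum es (F : config -> K) c : K :=
  if es is e :: es' then esum es' F (eupd c e true) + esum es' F (eupd c e false)
  else F c.

Lemma eq_esum es F G c : (forall c', F c' = G c') -> esum es F c = esum es G c.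
Proof. by move=> eqFG; elim: es c => //= e es IH c; rewrite !IH. Qed.

Lemma esum_cat es1 es2 F c : esum (es1 ++ es2) F c = esum es1 (esum es2 F) c.
Proof. by elim: es1 c => //= e es IH c; rewrite !IH. Qed.

Lemma esum_mull es (A B : config -> K) c :
  (forall e b c', e \in es -> A (eupd c' e b) = A c') ->
  esum es (fun c' => A c' * B c') c = A c * esum es B c.
Proof.
elim: es c => //= e es IH c invA.
rewrite !IH ?invA ?mem_head ?mulrDr // => e' b c' e'es;
  by rewrite invA // inE e'es orbT.
Qed.

(** [s j] and [s j.+1] are the edges above and to the right of a vertex, [h] and [b] those to the
    left and below; a horizontal edge is [true] when it points right. The zero values of [Wbulk]
    leave only the terms of [cross]. *)
Lemma crossE j u f s : cross j u f s = \sum_(h : bool) \sum_(b : bool)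
  Wbulk q h (~~ s j.+1) (~~ s j) b u * f (upd (upd s j h) j.+1 b).
Proof.
have sE : upd (upd s j (s j)) j.+1 (s j.+1) = s by rewrite !upd_id.
rewrite !big_bool /cross; move: sE.
by case: (s j) (s j.+1) => -[] /= ->; rewrite /weight_a /weight_b; ring.
Qed.

Lemma bounceE j u f s : bounce j u f s
  = \sum_(h : bool) Wright q (~~ s j) h u * f (upd s j h).
Proof.
have sE : upd s j (s j) = s by rewrite upd_id.
rewrite big_bool /bounce /Wright /weight_bounce; move: sE.
by case: (s j) => /= ->; ring.
Qed.

Lemma corner_Wleft u f s :
  corner u f s = Wleft q (~~ s 0) (~~ s 1%N) u * f (del 0 s).
Proof. by rewrite cornerE /Wleft /weight_bounce invrK; case: (s 0) (s 1%N) => -[]. Qed.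

Section Row.
Variables (k : nat).

(** The edges to the left of and below each of the first [t] bulk vertices of row [k], from right to
    left, the order in which the outermost crossing of [sweep] is peeled off. *)
Fixpoint bulk_edges t : seq edge :=
  if t is t'.+1 then
    (false, (k, k + t')%N) :: (true, (k.+1, k + t'.+1)%N) :: bulk_edges t'
  else [::].

Definition top c : state := fun p => c (true, (k, k + p)%N).
Definition bottom c : state := fun p => c (true, (k.+1, k.+1 + p)%N).

(* The cut that follows the top of row [k] up to its [t]-th bulk vertex, then
   descends and follows the bottom of the row. *)
Definition cut t c : state := fun p =>
  if (p <= t)%N then c (true, (k, k + p)%N)
  else if p == t.+1 then c (false, (k, k + t)%N)
  else c (true, (k.+1, k + p.-1)%N).

Definition bulk_weight c t w := Wbulk q (c (false, (k, k + t)%N))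
  (~~ c (false, (k, k + t.+1)%N)) (~~ c (true, (k, k + t.+1)%N))
  (c (true, (k.+1, k + t.+1)%N)) w.

Lemma mem_bulk_edges t e : e \in bulk_edges t ->
  exists2 t', (t' < t)%N & e = (false, (k, k + t')%N) \/ e = (true, (k.+1, k + t'.+1)%N).
Proof.
elim: t => //= t IH; rewrite !inE => /or3P [/eqP ->|/eqP ->|/IH [t' lt eqe]].
- by exists t => //; left.
- by exists t => //; right.
- by exists t'; first exact: ltnW.
Qed.

(** The weight of the rightmost vertex involves none of the edges listed for the vertices to its
    left, so it factors out of the inner sum and acts as one more crossing. *)
Lemma esum_bulk_edges u l g t c : (t <= size l)%N ->
  esum (bulk_edges t) (fun c' =>
    Wleft q (~~ c' (true, (k, k))) (~~ c' (false, (k, k))) u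
    * (\prod_(0 <= i < t) bulk_weight c' i l`_i) * g (bottom c')) c
  = sweep 1 (take t l) (corner u g) (cut t c).
Proof.
elim: t c => [|t IH] c le_tl.
  rewrite /= take0 big_geq //= mulr1 corner_Wleft /cut /= addn0.
  congr (_ * g _); apply: functional_extensionality => p.
  by rewrite /bottom /del /= addSnnS.
have IH' c' : esum (bulk_edges t) (fun c' =>
    Wleft q (~~ c' (true, (k, k))) (~~ c' (false, (k, k))) u
    * (\prod_(0 <= i < t.+1) bulk_weight c' i l`_i) * g (bottom c')) c'
  = bulk_weight c' t l`_t * sweep 1 (take t l) (corner u g) (cut t c').
  rewrite -IH 1?ltnW // -(@esum_mull _ (fun c => bulk_weight c t l`_t)).
    by apply: eq_esum => c''; rewrite big_nat_recr //=; ring.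
  move=> e b c'' /mem_bulk_edges [t' lt_t' [] ->];
    by rewrite /bulk_weight !eupdN // !xpair_eqE; lia.
rewrite [LHS]/= !IH' (take_nth 0) // -cats1 sweep_cat size_takel 1?ltnW // add1n.
rewrite [RHS]crossE !big_bool.
have cutE b1 b2 : upd (upd (cut t.+1 c) t.+1 b1) t.+2 b2 =
   cut t (eupd (eupd c (false, (k, k + t)%N) b1) (true, (k.+1, k + t.+1)%N) b2).
  apply: functional_extensionality => p.
  rewrite /upd /cut /eupd !xpair_eqE /= !eqxx (ltn_eqF (ltnSn k)) ?(gtn_eqF (ltnSn k)) /=.
  by repeat case: ifP => ?; solve [by [] | lia].
have bwE b1 b2 : bulk_weight
    (eupd (eupd c (false, (k, k + t)%N) b1) (true, (k.+1, k + t.+1)%N) b2) t l`_t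
  = Wbulk q b1 (~~ cut t.+1 c t.+2) (~~ cut t.+1 c t.+1) b2 l`_t.
  rewrite /bulk_weight /cut /eupd !xpair_eqE /= !eqxx (ltn_eqF (ltnSn k)) /=.
  by rewrite ltnn leqnn eqn_add2l (gtn_eqF (ltnSn t)).
by rewrite !cutE !bwE.
Qed.

(** States are infinite sequences, and those read off a configuration have irrelevant values beyond
    the last column; this expresses that [f] does not see them. *)
Definition supp N f := forall s s' : state,
  (forall p, (p < N)%N -> s p = s' p) -> f s = f s'.

Lemma supp_cross N j u f : (j.+1 < N)%N -> supp N f -> supp N (cross j u f).
Proof.
move=> ltjN supp_f s s' eq_s; rewrite /cross !eq_s ?(ltnW ltjN) //.
rewrite (supp_f s s') //; congr (if _ then _ else _ + _ * _).
apply: supp_f => p ltpN; rewrite /upd.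
by case: eqP => // _; case: eqP => // _; apply: eq_s.
Qed.

Lemma supp_sweep N p l f : (p + size l < N)%N -> supp N f -> supp N (sweep p l f).
Proof.
elim: l p f => //= u l IH p f lt_pN supp_f.
by apply: IH; [rewrite addSnnS | apply: supp_cross => //; lia].
Qed.

Lemma supp_bounce N j u f : (j < N)%N -> supp N f -> supp N (bounce j u f).
Proof.
move=> ltjN supp_f s s' eq_s; rewrite /bounce eq_s // (supp_f s s') //.
congr (_ + _ * _); apply: supp_f => p ltpN; rewrite /upd.
by case: eqP => // _; apply: eq_s.
Qed.

Lemma supp_corner N u f : supp N f -> supp N.+2 (corner u f).
Proof.
move=> supp_f s s' eq_s; rewrite !cornerE !eq_s //; congr (_ * _).
by apply: supp_f => p ltpN; rewrite /del /= eq_s.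
Qed.

Lemma supp_row_op u l f : supp (size l) f -> supp (size l).+2 (row_op u l f).
Proof.
by move=> supp_f; apply: supp_bounce => //; apply: supp_sweep => //; apply: supp_corner.
Qed.

Lemma supp_topsum us x : supp (size us).*2.+1 (topsum us x).
Proof.
elim: us => [|u us IH] //; rewrite topsum_cons doubleS.
rewrite -(size_pal us x) -(size_map ( *%R u)); apply: supp_row_op.
by rewrite size_map size_pal.
Qed.

Lemma esum_row u l g c : supp (size l) g ->
  esum ((false, (k, k + size l)%N) :: bulk_edges (size l)) (fun c' =>
    Wleft q (~~ c' (true, (k, k))) (~~ c' (false, (k, k))) u
    * (\prod_(0 <= i < size l) bulk_weight c' i l`_i)
    * Wright q (~~ c' (true, (k, k + (size l).+1)%N)) (c' (false, (k, k + size l)%N)) u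
    * g (bottom c')) c
  = row_op u l g (top c).
Proof.
move=> supp_g.
have rowE c' : esum (bulk_edges (size l)) (fun c' =>
    Wleft q (~~ c' (true, (k, k))) (~~ c' (false, (k, k))) u
    * (\prod_(0 <= i < size l) bulk_weight c' i l`_i)
    * Wright q (~~ c' (true, (k, k + (size l).+1)%N)) (c' (false, (k, k + size l)%N)) u
    * g (bottom c')) c'
  = Wright q (~~ c' (true, (k, k + (size l).+1)%N)) (c' (false, (k, k + size l)%N)) u
    * sweep 1 l (corner u g) (cut (size l) c').
  have := esum_bulk_edges u g c' (leqnn (size l)); rewrite take_size => <-.
  rewrite -(@esum_mull _ (fun c => Wright q (~~ c (true, (k, k + (size l).+1)%N))
    (c (false, (k, k + size l)%N)) u)).
    by apply: eq_esum => c''; ring.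
  move=> e b c'' /mem_bulk_edges [t' lt_t' [] ->];
    by rewrite !eupdN // !xpair_eqE; lia.
rewrite [LHS]/= !rowE /row_op bounceE big_bool.
have supp_f : supp (size l).+2 (sweep 1 l (corner u g)).
  by apply: supp_sweep => //; apply: supp_corner.
have cutE b : sweep 1 l (corner u g)
      (cut (size l) (eupd c (false, (k, k + size l)%N) b))
    = sweep 1 l (corner u g) (upd (top c) (size l).+1 b).
  apply: supp_f => p ltp; rewrite /upd /cut /eupd /top !xpair_eqE /= !eqxx.
  move: ltp; rewrite ltnS leq_eqVlt => /predU1P [->|lep]; first by rewrite ltnn eqxx.
  by rewrite -ltnS lep (ltn_eqF lep).
by rewrite !cutE !eupdE !eupdN.
Qed.

End Row.

Section Rows.
Variables (n : nat) (u : nat -> K).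

Definition row_weight (c : config) i :=
  let i' := ((2 * n).+2 - i)%N in
  Wleft q (~~ c (true, (i, i))) (~~ c (false, (i, i))) (u i)
  * (\prod_(i.+1 <= j < i')
       Wbulk q (c (false, (i, j.-1))) (~~ c (false, (i, j)))
         (~~ c (true, (i, j))) (c (true, (i.+1, j)))
         (u i * u (minn j ((2 * n).+2 - j))))
  * Wright q (~~ c (true, (i, i'))) (c (false, (i, i'.-1))) (u i).

Definition row_edges i : seq edge :=
  let t := ((2 * n).+1 - i.*2)%N in (false, (i, i + t)%N) :: bulk_edges i t.

Lemma nth_pal i t : (0 < i <= n)%N -> (t < (2 * n).+1 - i.*2)%N ->
  (map ( *%R (u i)) (pal (map u (iota i.+1 (n - i))) (u n.+1)))`_t
  = u i * u (minn (i + t.+1) ((2 * n).+2 - (i + t.+1))).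
Proof.
move=> /andP [i0 le_in] lt_t.
have sp : size (pal (map u (iota i.+1 (n - i))) (u n.+1)) = ((2 * n).+1 - i.*2)%N.
  by rewrite size_pal size_map size_iota; lia.
rewrite (nth_map 0) ?sp //; congr (_ * _).
rewrite /pal nth_cat size_map size_iota; case: ltnP => lt1.
  by rewrite (nth_map 0%N) ?size_iota // nth_iota //; congr u; lia.
case Et: (t - (n - i))%N => [|t'] /=; first by congr u; lia.
rewrite nth_rev ?size_map ?size_iota; last by lia.
rewrite (nth_map 0%N) ?size_iota; last by lia.
by rewrite nth_iota; [congr u; lia | lia].
Qed.

Lemma esum_row_edges i g c : (0 < i <= n)%N -> supp ((2 * n).+1 - i.*2) g ->
  esum (row_edges i) (fun c' => row_weight c' i * g (bottom i c')) c
  = row_op (u i) (map ( *%R (u i)) (pal (map u (iota i.+1 (n - i))) (u n.+1)))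
      g (top i c).
Proof.
move=> /andP [i0 le_in].
set l := map _ _.
have sl : size l = ((2 * n).+1 - i.*2)%N.
  by rewrite size_map size_pal size_map size_iota; lia.
rewrite /row_edges -sl => supp_g; rewrite -esum_row //.
apply: eq_esum => c'; rewrite /row_weight; congr (_ * _ * _ * _).
  have -> : ((2 * n).+2 - i = size l + i.+1)%N by rewrite sl; lia.
  rewrite -{1}[i.+1]add0n big_addn addnK; apply: eq_big_nat => t /andP [_ lt_t].
  have -> : (t + i.+1 = i + t.+1)%N by lia.
  by rewrite /bulk_weight nth_pal ?i0 -?sl // !addnS.
have -> : ((2 * n).+2 - i = i + (size l).+1)%N by rewrite sl; lia.
by rewrite addnS.
Qed.

Definition rows_from k := flatten (map row_edges (iota k (n.+1 - k))).

Lemma top_bottom k c : bottom k c = top k.+1 c.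
Proof. by []. Qed.

Lemma mem_rows_from k e : e \in rows_from k -> exists2 i, (k <= i < n.+1)%N &
  exists2 t, (t <= (2 * n).+1 - i.*2)%N &
  e = (false, (i, i + t)%N) \/ e = (true, (i.+1, i + t)%N) /\ (0 < t)%N.
Proof.
case/flattenP => es /mapP [i + ->]; rewrite mem_iota => lt_i.
rewrite inE => ei; exists i; first by lia.
case/predU1P: ei => [->|/mem_bulk_edges [t lt_t [] ->]].
- by exists ((2 * n).+1 - i.*2)%N => //; left.
- by exists t; [exact: ltnW | left].
- by exists t.+1 => //; right.
Qed.

Lemma row_weight_eupd k e b c : e \in rows_from k.+1 -> (k <= n)%N ->
  row_weight (eupd c e b) k = row_weight c k.
Proof.
case/mem_rows_from => i /andP [lt_ki lt_in] [t _ eqe] le_kn.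
have eupd_ne e' : e'.2.1 = k \/ e'.2.1 = k.+1 /\ e'.1 -> eupd c e b e' = c e'.
  case: e' => d [i' j'] /= e'P; apply: eupdN; apply/eqP => ee'.
  by move: eqe; rewrite -ee' => -[[]|[[]]]; case: e'P; lia.
rewrite /row_weight !eupd_ne /=; try by [left | right].
congr (_ * _ * _); apply: eq_bigr => j _.
by rewrite !eupd_ne /=; try by [left | right].
Qed.

Lemma esum_rows_from k c : (0 < k <= n.+1)%N ->
  esum (rows_from k) (fun c' => \prod_(k <= i < n.+1) row_weight c' i) c
  = topsum (map u (iota k (n.+1 - k))) (u n.+1) (top k c).
Proof.
move=> /andP [k0 le_kn]; move Ed: (n.+1 - k)%N => d.
elim: d k k0 le_kn Ed c => [|d IH] k k0 le_kn Ed c.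
  by rewrite /rows_from Ed /= big_geq //; lia.
have -> : rows_from k = row_edges k ++ rows_from k.+1.
  by rewrite /rows_from Ed; congr (_ ++ flatten (map _ (iota _ _))); lia.
rewrite esum_cat [iota k d.+1]/= map_cons topsum_cons.
have lt_kn : (0 < k <= n)%N by lia.
have -> : d = (n - k)%N by lia.
rewrite -esum_row_edges //; last first.
  have := @supp_topsum (map u (iota k.+1 (n - k))) (u n.+1).
  by rewrite size_map size_iota; congr (supp _ _); lia.
apply: eq_esum => c'; rewrite -[(n - k)%N](_ : d = _); last by lia.
rewrite top_bottom -IH //; [|lia|lia].
rewrite -(@esum_mull _ (row_weight^~ k)).
  by apply: eq_esum => c''; rewrite big_ltn //; lia.
by move=> e b c'' ek; apply: row_weight_eupd => //; lia.
Qed.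

Lemma mem_rows e : (e \in rows_from 1) =
  if e.1 then [&& 1 < e.2.1, e.2.1 <= n.+1, e.2.1 <= e.2.2
                & e.2.2 <= (2 * n).+2 - e.2.1]%N
  else [&& 1 <= e.2.1, e.2.1 <= n, e.2.1 <= e.2.2
         & e.2.2 <= (2 * n).+1 - e.2.1]%N.
Proof.
have mem_bulk_t k t t' : (t' < t)%N ->
    (false, (k, k + t')%N) \in bulk_edges k t /\
    (true, (k.+1, k + t'.+1)%N) \in bulk_edges k t.
  elim: t => //= t IH; rewrite ltnS leq_eqVlt !inE => /predU1P [->|/IH [-> ->]].
    by rewrite !eqxx /= ?orbT.
  by rewrite !orbT.
apply/idP/idP => [/mem_rows_from [i lt_i [t lt_t [->|[-> t0]]]] /=|].
- by lia.
- by lia.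
case: e => d [i j] /= H; apply/flattenP; case: d H => H; last first.
  exists (row_edges i); first by apply: map_f; rewrite mem_iota; lia.
  rewrite inE; have -> : j = (i + (j - i))%N by lia.
  have [lt_t|ge_t] := ltnP (j - i) ((2 * n).+1 - i.*2).
    by have [-> _] := mem_bulk_t i _ _ lt_t; rewrite orbT.
  by apply/orP; left; apply/eqP; congr (_, (_, _)); lia.
exists (row_edges i.-1); first by apply: map_f; rewrite mem_iota; lia.
rewrite inE; have lt_t : (j - i < (2 * n).+1 - i.-1.*2)%N by lia.
have [_] := mem_bulk_t i.-1 _ _ lt_t.
have -> : (i.-1.+1 = i)%N by lia.
by have -> : (i.-1 + (j - i).+1 = j)%N by lia.
Qed.

Lemma uniq_rows_from k : (0 < k <= n.+1)%N -> uniq (rows_from k).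
Proof.
move=> /andP [k0 le_kn]; move Ed: (n.+1 - k)%N => d.
elim: d k k0 le_kn Ed => [|d IH] k k0 le_kn Ed.
  by rewrite /rows_from Ed.
have uniq_bulk t : uniq (bulk_edges k t).
  elim: t => //= t ->; rewrite inE !xpair_eqE /= andbT.
  by apply/andP; split; apply/negP => /mem_bulk_edges [t' lt_t' [] []]; lia.
have -> : rows_from k = row_edges k ++ rows_from k.+1.
  by rewrite /rows_from Ed; congr (_ ++ flatten (map _ (iota _ _))); lia.
rewrite cat_uniq IH ?andbT /= ?uniq_bulk ?andbT; [|lia|lia|lia].
apply/andP; split.
  by apply/negP => /mem_bulk_edges [t' lt_t' [] // []]; lia.
apply/hasPn => e /mem_rows_from [i lt_i [t _ eqe]].
rewrite inE negb_or; apply/andP; split.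
  by apply/eqP => ee; move: eqe; rewrite ee => -[[]|[]//]; lia.
by apply/negP => /mem_bulk_edges [t' _ []] ee; move: eqe; rewrite ee => -[[]|[[]]] //; lia.
Qed.

End Rows.

Section Sets.
Variable n : nat.

Definition ept (e : edge) : box n := pt n e.2.1 e.2.2.

Definition cfg (C : arrows n) : config :=
  fun e => ept e \in (if e.1 then C.2 else C.1).

Definition in_box (e : edge) := (0 < e.2.1 < n.+2)%N && (0 < e.2.2 < (2 * n).+2)%N.

(** An index out of range is sent to 0, so it cannot collide with a positive one. Rows and columns
    of edges start at 1 for this reason. *)
Lemma inord_eq m i j : (0 < j < m.+1)%N -> (inord i == inord j :> 'I_m.+1) = (i == j).
Proof.
move=> /andP [j0 ltj]; rewrite -val_eqE /= [X in _ == X]inordK // /inord val_insubd.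
by case: ifP => //= ltmi; apply/eqP/eqP; lia.
Qed.

Lemma ept_eq d e e' : in_box e -> e.1 = d -> e'.1 = d -> (ept e' == ept e) = (e' == e).
Proof.
case: e e' => [d1 [i j]] [d2 [i' j']] /andP [/= Hi Hj] -> ->.
by rewrite /ept /pt /= !xpair_eqE !inord_eq // eqxx.
Qed.

Definition epts d (es : seq edge) : {set box n} :=
  [set v | v \in [seq ept e | e <- es & e.1 == d]].

Lemma epts_cons d e es :
  epts d (e :: es) = if e.1 == d then ept e |: epts d es else epts d es.
Proof. by apply/setP => v; rewrite inE /=; case: ifP => _; rewrite !inE. Qed.

Definition between es (B C : arrows n) :=
  [&& B.1 \subset C.1, C.1 \subset B.1 :|: epts false es,
      B.2 \subset C.2 & C.2 \subset B.2 :|: epts true es].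

Lemma between_in (A B S : {set box n}) p :
  [&& B \subset A, A \subset B :|: (p |: S) & p \in A]
  = (p |: B \subset A) && (A \subset (p |: B) :|: S).
Proof.
by rewrite subUset sub1set setUCA setUA andbA andbC andbA.
Qed.

Lemma between_out (A B S : {set box n}) p : p \notin B -> p \notin S ->
  [&& B \subset A, A \subset B :|: (p |: S) & p \notin A]
  = (B \subset A) && (A \subset B :|: S).
Proof.
move=> pB pS; rewrite -subsetD1 setUCA setU1K //.
by rewrite inE negb_or pB.
Qed.

(** Induction on the list: the configurations that contain its first edge are those between the
    enlarged [B] and the same upper bound, and the others never meet that edge again. *)
Lemma sum_between es (B : arrows n) (F : config -> K) : uniq es ->
  {in es, forall e, in_box e && ~~ cfg B e} ->
  \sum_(C | between es B C) F (cfg C) = esum es F (cfg B).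
Proof.
elim: es B => [|e es IH] B /=.
  move=> _ _; rewrite (big_pred1 B) // => C.
  have epts0 d : epts d [::] = set0 by apply/setP => v; rewrite !inE.
  rewrite /between !epts0 !setU0 /= andbA -!eqEsubset.
  by case: B C => B1 B2 [C1 C2]; rewrite -pair_eqE /= [B1 == _]eq_sym [B2 == _]eq_sym.
move=> /andP [e_es uniq_es] esP.
have /andP [e_box e_B] := esP e (mem_head _ _).
have e_epts : ept e \notin epts e.1 es.
  rewrite inE; apply: contra e_es => /mapP [e' + /eqP].
  rewrite mem_filter => /andP [/eqP de' e'es]; rewrite eq_sym (ept_eq e_box erefl de').
  by move/eqP <-.
pose B' : arrows n := if e.1 then (B.1, ept e |: B.2) else (ept e |: B.1, B.2).
have cfgB' : cfg B' = eupd (cfg B) e true.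
  apply: functional_extensionality => e'; rewrite /cfg /eupd /B'.
  case: (boolP (e'.1 == e.1)) => [/eqP de|de].
    by rewrite de -(ept_eq e_box erefl de); case: (e.1); rewrite /= !inE; case: eqP.
  have /negbTE -> : e' != e by apply: contra de => /eqP ->.
  by case: (e'.1) de; case: (e.1).
have cfgB : eupd (cfg B) e false = cfg B.
  apply: functional_extensionality => e'; rewrite /eupd; case: eqP => // ->.
  exact/esym/negbTE.
rewrite cfgB -cfgB' (bigID (fun C => cfg C e)) /=; congr (_ + _).
  rewrite -IH //; last first.
    move=> e' e'es; have /andP [-> /=] := esP e' (mem_behead (s := e :: es) e'es).
    rewrite cfgB' /eupd; case: eqP => // ee.
    by rewrite -ee e'es in e_es.
  apply: eq_bigl => C; rewrite /between !epts_cons /cfg /B'.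
  case: (e.1) => /=.
    by rewrite -!andbA between_in.
  by rewrite [RHS]andbA -between_in; do !case: (_ \subset _) => //=; rewrite ?andbF ?andbT.
rewrite -IH //; last first.
  by move=> e' e'es; apply: esP; rewrite inE e'es orbT.
apply: eq_bigl => C; rewrite /between !epts_cons /cfg.
move: e_B e_epts; rewrite /cfg; case: (e.1) => /= pB pS.
  by rewrite -!andbA between_out.
rewrite [RHS]andbA -(between_out _ pB pS).
by do !case: (_ \subset _) => //=; rewrite ?andbF ?andbT.
Qed.

End Sets.

Lemma Wbulk_neq0 l r a b w : Wbulk q l r a b w != 0 -> (l + r + a + b == 2)%N.
Proof. by case: l r a b => -[] [] []; rewrite //= eqxx. Qed.

Lemma mem_epts n d (v : box n) :
  (v \in epts n d (rows_from n 1)) = ((d, (v.1 : nat, v.2 : nat)) \in rows_from n 1).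
Proof.
rewrite inE; apply/mapP/idP => [[e]|vr]; last first.
  exists (d, (v.1 : nat, v.2 : nat)); first by rewrite mem_filter eqxx.
  by case: v {vr} => a b; rewrite /ept /pt /= !inord_val.
rewrite mem_filter => /andP [/eqP <- er] ->; rewrite /ept /=.
have := er; rewrite mem_rows => eP.
by rewrite !inordK -?surjective_pairing //; case: ifP eP => _; lia.
Qed.

(** Allows the sum to run over all orientations with upward top edges, since those violating the
    six-vertex condition contribute 0. *)
Lemma row_weight_eq0 n u (C : arrows n) (v : box n) : bulk n v.1 v.2 ->
  (inL C v.1 v.2 + inR C v.1 v.2 + inA C v.1 v.2 + inB C v.1 v.2 != 2)%N ->
  \prod_(1 <= i < n.+1) row_weight n u (cfg C) i = 0.
Proof.
case/and4P => v1 v2 v3 v4 n2; apply/eqP; rewrite prodf_seq_eq0; apply/hasP.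
exists (v.1 : nat); first by rewrite mem_index_iota v1.
rewrite /= /row_weight !mulf_eq0 prodf_seq_eq0; apply/orP; left; apply/orP; right.
apply/hasP; exists (v.2 : nat); first by rewrite mem_index_iota v3.
by rewrite /=; apply: contraNT n2 => /Wbulk_neq0.
Qed.

Theorem Z_topsum n (u : nat -> K) :
  Z n q u = topsum (map u (iota 1 n)) (u n.+1) all_up.
Proof.
pose F c := \prod_(1 <= i < n.+1) row_weight n u c i.
have -> : Z n q u = \sum_(C : arrows n | six_vertex C) F (cfg C) by [].
(* [B] holds just the arrows forced by the top vertices; all remaining edges are free and are listed
   by [rows_from n 1]. *)
pose B : arrows n := (set0, [set v in vedges n | v.1 == 1%N :> nat]).
have eptsH : epts n false (rows_from n 1) = hedges n.
  by apply/setP => v; rewrite mem_epts mem_rows inE.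
have vedgesE : B.2 :|: epts n true (rows_from n 1) = vedges n.
  apply/setP => v; rewrite inE mem_epts mem_rows !inE /=.
  by case: (v.1) (v.2) => a lta [b ltb] /=; lia.
have topE (C : arrows n) : [forall j : 'I_(2 * n).+2, (1 <= j)%N ==> (pt n 1 j \in C.2)]
   = (B.2 \subset C.2).
  apply/forallP/subsetP => [H [a b]|H j].
    rewrite !inE /= => /andP [ab /eqP a1]; have := H b.
    have -> : pt n 1 b = (a, b).
      by rewrite /pt inord_val; congr (_, _); apply: val_inj; rewrite /= inordK ?a1.
    by move/implyP; apply; case/and4P: ab; rewrite a1.
  apply/implyP => j0; apply: H; rewrite !inE /= !inordK //.
  by have := ltn_ord j; lia.
have -> : \sum_(C : arrows n | six_vertex C) F (cfg C)
    = \sum_(C | between (rows_from n 1) B C) F (cfg C).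
  rewrite [RHS](bigID (fun C => [forall v : box n, bulk n v.1 v.2 ==>
    (inL C v.1 v.2 + inR C v.1 v.2 + inA C v.1 v.2 + inB C v.1 v.2 == 2)%N])) /=.
  rewrite [X in _ + X]big1 ?addr0 => [|C /andP [_ /forallPn [v]]]; last first.
    by rewrite negb_imply => /andP [vb v2]; apply: row_weight_eq0 vb v2.
  apply: eq_bigl => C; rewrite /six_vertex /between topE eptsH vedgesE /orientation.
  by rewrite sub0set set0U /= -!andbA; do !case: (_ \subset _) => //=; rewrite ?andbF.
rewrite sum_between ?uniq_rows_from //.
  rewrite esum_rows_from // subn1 /=.
  apply: supp_topsum => p; rewrite size_map size_iota => lt_p.
  rewrite /top /cfg /ept /= /all_up !inE /= !inordK //; lia.
move=> e; rewrite mem_rows => eP; apply/andP; split.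
  by move: eP; rewrite /in_box; case: ifP => _; lia.
rewrite /cfg; case: ifP eP => [_ eP|]; last by rewrite inE.
by rewrite !inE /ept /= !inordK; lia.
Qed.

End Bridge.

(** * Degree of the partition function in the central parameter *)

Section TopSumLaurent.
Implicit Types (f : K -> state -> K) (us l : seq K) (d N : nat).

Definition laurents d N f := forall s, laurent d N (fun x => f x s).

Lemma laurents_cross d N j a f : laurents d N f ->
  laurents d N (fun x => cross j a (f x)).
Proof.
move=> lf s; rewrite /cross; case: (s j == s j.+1); first exact: laurentZ (lf s).
exact: laurentD (lf s) (laurentZ _ (lf _)).
Qed.

Lemma laurents_crossX d N j a f : laurents d N f ->
  laurents d.+1 N.+2 (fun x => cross j (a * x) (f x)).
Proof.
move=> lf s; rewrite /cross /weight_a /weight_b; case: (s j == s j.+1).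
  apply: eq_laurent (laurentM (laurentZ (sigma (q ^+ 4))^-1
    (laurent_sigma (q ^+ 2 * a))) (lf s)).
  by move=> x _; rewrite mulrA [_^-1 * _]mulrC.
apply: laurentD; first by apply: laurent_weaken (lf s) _ _; rewrite ?addSn ?addnS.
apply: eq_laurent (laurentM (laurentZ (sigma (q ^+ 4))^-1
  (laurent_sigmaV (q ^+ 2 / a))) (lf _)).
by move=> x _; rewrite [_^-1 * _]mulrC invfM mulrA.
Qed.

Lemma laurents_sweep d N p l f : laurents d N f ->
  laurents d N (fun x => sweep p l (f x)).
Proof.
elim: l p f => //= u l IH p f lf.
by apply: (IH _ (fun x => cross p u (f x))); apply: laurents_cross.
Qed.

Lemma laurents_bounce d N j a f : laurents d N f ->
  laurents d N (fun x => bounce j a (f x)).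
Proof. by move=> lf s; exact: laurentD (lf s) (laurentZ _ (lf _)). Qed.

Lemma laurents_corner d N a f : laurents d N f ->
  laurents d N (fun x => corner a (f x)).
Proof.
move=> lf s; apply: eq_laurent (laurentZ _ (lf (del 0 s))) => x _.
by rewrite cornerE.
Qed.

(** The central parameter enters each row through its middle crossing only, with exponents between
    -1 and 1. *)
Lemma laurents_topsum us : laurents (size us) (size us).*2 (topsum us).
Proof.
elim: us => [|u us IH] /=; first by move=> s; apply: laurentC.
rewrite doubleS => s.
have := @laurents_bounce _ _ (size us).*2.+2 u _
  (@laurents_sweep _ _ (size us).+2 (map ( *%R u) (rev us)) _
    (@laurents_crossX _ _ (size us).+1 u _
      (@laurents_sweep _ _ 1 (map ( *%R u) us) _ (@laurents_corner _ _ u _ IH)))) s.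
apply: eq_laurent => x _.
by rewrite /row_op size_map size_pal /pal map_cat sweep_cat size_map add1n.
Qed.

End TopSumLaurent.

(** * The sum of the two determinants as a function of the central parameter *)

Section Determinants.
Implicit Types (u v x : K) (w c : nat -> K) (n : nat).

Definition sigma2 u v := sigma (q ^+ 2 * u * v) * sigma (q ^+ 2 * u^-1 * v^-1).
Definition numer u v := q ^+ 2 + q^-1 ^+ 2 + u ^+ 2 + v^-1 ^+ 2.

Lemma sigma2C u v : sigma2 u v = sigma2 v u.
Proof. by rewrite /sigma2 mulrAC [_ * u^-1 * _]mulrAC. Qed.

Lemma sigma2V u v : sigma2 u^-1 v^-1 = sigma2 u v.
Proof. by rewrite /sigma2 !invrK mulrC. Qed.

Lemma sigma2N u v : sigma2 (- u) v = sigma2 u v.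
Proof. by rewrite /sigma2 invrN !mulrN !mulNr !sigmaN mulrNN. Qed.

Lemma numerV u v : numer u^-1 v^-1 = numer v u.
Proof. by rewrite /numer invrK addrAC. Qed.

Lemma numerNl u v : numer (- u) v = numer u v.
Proof. by rewrite /numer sqrrN. Qed.

Lemma numerNr u v : numer u (- v) = numer u v.
Proof. by rewrite /numer invrN sqrrN. Qed.

(* The first [n] columns are those of [matM], without the factor
   [u n.+1 - 1] of the last row; the last column is [c]. *)
Definition colmx n w c : 'M[K]_n.+1 := \matrix_(i, j)
  if (j < n)%N then
    if (i < n)%N then numer (w i) (w j) / sigma2 (w i) (w j) else (w j ^+ 2 - 1)^-1
  else c i.

Definition lastcol n w i :=
  if (i < n)%N then numer (w i) (w n) / sigma2 (w i) (w n) else (w n ^+ 2 - 1)^-1.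

Definition detN n w := \det (colmx n w (lastcol n w)).

(** The cofactors do not depend on the last column, for which 0 is a placeholder. *)
Definition cof n w (i : 'I_n.+1) := cofactor (colmx n w (fun=> 0)) i ord_max.
Arguments cof : clear implicits.

Lemma det_colmx n w c : \det (colmx n w c) = \sum_(i < n.+1) c i * cof n w i.
Proof.
rewrite (expand_det_col _ ord_max); apply: eq_bigr => i _.
rewrite mxE ltnn; congr (_ * (_ * \det _)).
by apply/matrixP => a b; rewrite !mxE lift_max ltn_ord.
Qed.

(** Inverting the parameters transposes this minor: [numer] exchanges its arguments, while [sigma2]
    is symmetric and unchanged. *)
Lemma cof_max_inv n w : cof n (GRing.inv \o w) ord_max = cof n w ord_max.
Proof.
rewrite /cof /cofactor; congr (_ * _); rewrite -det_tr; congr (\det _).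
apply/matrixP => a b; rewrite !mxE !lift_max !ltn_ord /=.
by rewrite numerV sigma2V sigma2C.
Qed.

(** Without row [m] and the last column, column [m] becomes the last one and [w m] takes the role of
    the central parameter. The sign is $(-1)^{m+(m+1)}$. *)
Lemma cof_penult m w : cof m.+1 w (inord m) = - detN m w.
Proof.
rewrite /cof /cofactor inordK //= addnS exprS addnn -signr_odd odd_double /=.
rewrite expr0 mulr1 mulN1r; congr (- \det _).
apply/matrixP => a b; rewrite !mxE lift_max /lastcol /= inordK // ltn_ord /bump.
have ord_m (d : 'I_m.+1) : (m <= d)%N -> d = m :> nat.
  by move=> le_md; apply/eqP; rewrite eqn_leq le_md -ltnS ltn_ord.
case: (ltnP a m) (ltnP b m) => [lt_am|le_ma] [lt_bm|/ord_m ->] //=;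
  by rewrite ?add0n ?add1n ltnS ?(ltnW lt_am) ?ltnNge ?le_ma.
Qed.

(** Rows and columns undergo the same permutation, so the two signs cancel. *)
Lemma det_colmx_perm n (p : 'S_n.+1) w w' c c' : p ord_max = ord_max ->
  (forall i : 'I_n.+1, (i < n)%N -> w' i = w (p i)) ->
  (forall i : 'I_n.+1, c' i = c (p i)) ->
  \det (colmx n w' c') = \det (colmx n w c).
Proof.
move=> pmax w'E c'E.
have pn (i : 'I_n.+1) : (p i < n)%N = (i < n)%N.
  have ltE (j : 'I_n.+1) : (j < n)%N = (j != ord_max).
    by rewrite -val_eqE /= ltn_neqAle -ltnS ltn_ord andbT.
  by rewrite !ltE -{1}pmax (inj_eq perm_inj).
have -> : colmx n w' c' = row_perm p (col_perm p (colmx n w c)).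
  apply/matrixP => i j; rewrite !mxE !pn; case: ifP => jn; last exact: c'E.
  by case: ifP => inn; rewrite !w'E.
rewrite row_permE col_permE !det_mulmx !det_perm odd_permV mulrCA -signr_addb.
by rewrite addbb mulr1.
Qed.

Definition others n w x i := \prod_(j < n | j != i :> nat) sigma2 (w j) x.

Definition detcol n w x i :=
  if (i < n)%N then (x - 1) * numer (w i) x * others n w x i
  else \prod_(j < n) sigma2 (w j) x.

Definition detcol' n w x i :=
  if (i < n)%N then (x^-1 - 1) * numer (w i)^-1 x^-1 * others n w x i
  else 0.

(* [(\det M + \det M') * \prod_(j < n) sigma2 (w j) x] without denominators in
   [x].  The cofactors at the bottom right of the two matrices coincide, and
   their coefficients add up to 1, which is put entirely on the first one. *)
Definition detsum n w x := \det (colmx n w (detcol n w x))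
  + \det (colmx n (GRing.inv \o w) (detcol' n w x)).

Lemma detsum_perm n (p : 'S_n) w w' x : (forall i : 'I_n, w' i = w (p i)) ->
  detsum n w' x = detsum n w x.
Proof.
move=> w'E; pose p' := lift_perm ord_max ord_max p.
have p'max : p' ord_max = ord_max by rewrite lift_perm_id.
have oE (i : 'I_n) : others n w' x i = others n w x (p i).
  rewrite /others [RHS](reindex_inj (@perm_inj _ p)) /=.
  apply: eq_big => j; first by rewrite !val_eqE (inj_eq perm_inj).
  by rewrite w'E.
have GE : \prod_(j < n) sigma2 (w' j) x = \prod_(j < n) sigma2 (w j) x.
  rewrite [RHS](reindex_inj (@perm_inj _ p)) /=.
  by apply: eq_bigr => j _; rewrite w'E.
have liftE (i : 'I_n.+1) : (i < n)%N ->
    exists2 i' : 'I_n, i = i' :> nat & p' i = p i' :> nat.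
  move=> lt_in; exists (Ordinal lt_in) => //.
  have iE : i = lift ord_max (Ordinal lt_in) by exact/val_inj/esym/lift_max.
  by rewrite {1}iE lift_perm_lift lift_max.
have p'n (i : 'I_n.+1) : (n <= i)%N -> p' i = ord_max.
  move=> le_ni; rewrite -[RHS]p'max; congr (p' _); apply/val_inj => /=.
  by apply/eqP; rewrite eqn_leq le_ni -ltnS ltn_ord.
have w'p (i : 'I_n.+1) : (i < n)%N -> w' i = w (p' i).
  by case/liftE => i' -> ->; rewrite w'E.
congr (_ + _); apply: (@det_colmx_perm _ p') => // i /=.
- rewrite /detcol; case: ltnP => [/liftE [i' -> ->]|/p'n ->]; last by rewrite ltnn.
  by rewrite ltn_ord w'E oE.
- by move=> /w'p ->.
- rewrite /detcol'; case: ltnP => [/liftE [i' -> ->]|/p'n ->]; last by rewrite ltnn.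
  by rewrite ltn_ord w'E oE.
Qed.

Lemma eq_colmx n w w' c c' :
  (forall i, (i < n)%N -> w' i = w i \/ w' i = - w i) ->
  (forall i : 'I_n.+1, c' i = c i) -> colmx n w' c' = colmx n w c.
Proof.
move=> w'E c'E; apply/matrixP => i j; rewrite !mxE c'E; case: ifP => // jn.
case: ifP => [inn|_]; last by have [->|->] := w'E j jn; rewrite ?sqrrN.
have [->|->] := w'E i inn; have [->|->] := w'E j jn;
  by rewrite ?numerNl ?numerNr ?sigma2N ?[sigma2 _ (- _)]sigma2C ?sigma2N //
       [sigma2 (w j) _]sigma2C.
Qed.

(** All entries are even in each parameter. The case of equal values makes this also the
    extensionality lemma for the first [n] values of [w]. *)
Lemma detsum_sign n w w' x :
  (forall i, (i < n)%N -> w' i = w i \/ w' i = - w i) -> detsum n w' x = detsum n w x.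
Proof.
move=> w'E.
have gE i y : (i < n)%N -> sigma2 (w' i) y = sigma2 (w i) y.
  by move=> /w'E [] ->; rewrite ?sigma2N.
have oE i : others n w' x i = others n w x i.
  by apply: eq_bigr => j _; rewrite gE.
rewrite /detsum; congr (_ + _); congr (\det _); apply: eq_colmx => // i.
- rewrite /detcol; case: ifP => [inn|_]; last by apply: eq_bigr => j _; rewrite gE.
  by rewrite oE; have [->|->] := w'E i inn; rewrite ?numerNl.
- by move=> /w'E /= [] ->; [left | right; rewrite invrN].
rewrite /detcol'; case: ifP => // inn.
by rewrite oE; have [->|->] := w'E i inn; rewrite ?invrN ?numerNl.
Qed.

Lemma detsum_expand n w x : detsum n w x =
  \sum_(i < n) ((x - 1) * numer (w i) x * cof n w (widen_ord (leqnSn n) i)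
    + (x^-1 - 1) * numer (w i)^-1 x^-1 * cof n (GRing.inv \o w) (widen_ord (leqnSn n) i))
      * others n w x i
  + (\prod_(j < n) sigma2 (w j) x) * cof n w ord_max.
Proof.
rewrite /detsum !det_colmx !big_ord_recr /= /detcol /detcol' ltnn mul0r addr0 addrAC.
congr (_ + _); rewrite -big_split; apply: eq_bigr => i _ /=; rewrite ltn_ord.
by ring.
Qed.

Lemma detsum_inv n w x : detsum n (GRing.inv \o w) x^-1 = detsum n w x.
Proof.
rewrite !detsum_expand cof_max_inv; congr (_ + _ * _); last first.
  by apply: eq_bigr => j _; rewrite /= sigma2V.
apply: eq_bigr => i _.
have -> : GRing.inv \o (GRing.inv \o w) = w.
  by apply: functional_extensionality => k; rewrite /= invrK.
have -> : others n (GRing.inv \o w) x^-1 i = others n w x i.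
  by apply: eq_bigr => j _; rewrite /= sigma2V.
by rewrite /= !invrK addrC.
Qed.

Lemma detN_expand n w : detN n w =
  \sum_(i < n) numer (w i) (w n) / sigma2 (w i) (w n) * cof n w (widen_ord (leqnSn n) i)
  + (w n ^+ 2 - 1)^-1 * cof n w ord_max.
Proof.
rewrite /detN det_colmx big_ord_recr /= /lastcol ltnn; congr (_ + _).
by apply: eq_bigr => i _; rewrite /= ltn_ord.
Qed.

Lemma prod_others n w x (i : 'I_n) :
  \prod_(j < n) sigma2 (w j) x = sigma2 (w i) x * others n w x i.
Proof. by rewrite (bigD1 i). Qed.

Lemma detsum_detN n w : let x := w n in
  x != 0 -> x ^+ 2 != 1 -> (forall j, (j < n)%N -> sigma2 (w j) x != 0) ->
  detsum n w x = (\prod_(j < n) sigma2 (w j) x)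
    * ((x - 1) * detN n w + (x^-1 - 1) * detN n (GRing.inv \o w)).
Proof.
move=> x x0 x1 g0.
rewrite detsum_expand !detN_expand /= -/x cof_max_inv !mulrDr !mulr_sumr addrACA.
rewrite -big_split /=; congr (_ + _).
  apply: eq_bigr => i _; rewrite sigma2V (prod_others _ _ i).
  by field; rewrite g0.
(* What remains is the coefficient of the common corner cofactor,
   $(x-1)/(x^2-1)+(x^{-1}-1)/(x^{-2}-1)=1$. *)
have xp : x + 1 != 0.
  by apply: contra x1 => /eqP xN; rewrite -subr_eq0 subr_sqr_1 xN mulr0.
have xm : x - 1 != 0.
  by apply: contra x1 => /eqP xN; rewrite -subr_eq0 subr_sqr_1 xN mul0r.
have -> : x ^+ 2 - 1 = (x - 1) * (x + 1) by ring.
have -> : x^-1 ^+ 2 - 1 = - (x - 1) * (x + 1) / x ^+ 2 by field.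
by field; rewrite oppr_eq0 x0 xp xm.
Qed.

(** All terms of the expansion but the one of row [m] contain the vanishing factor
    [sigma2 (w m) x]. *)
Lemma detsum_penult m w x : sigma2 (w m) x = 0 ->
  detsum m.+1 w x = - (\prod_(j < m) sigma2 (w j) x)
    * ((x - 1) * numer (w m) x * detN m w
       + (x^-1 - 1) * numer (w m)^-1 x^-1 * detN m (GRing.inv \o w)).
Proof.
move=> g0; rewrite detsum_expand big_ord_recr /= big_ord_recr /= g0 mulr0 mul0r addr0.
rewrite big1 ?add0r => [|i _]; last first.
  rewrite /others (bigD1 ord_max) /=; last by rewrite gtn_eqF.
  by rewrite g0 mul0r mulr0.
have -> : widen_ord (leqnSn m.+1) ord_max = inord m.
  by apply: val_inj; rewrite /= inordK.
rewrite !cof_penult /others big_mkcond big_ord_recr /= eqxx mulr1.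
under eq_bigr => j _ do rewrite (ltn_eqF (ltn_ord j)) /=.
by ring.
Qed.

Lemma detN_eq0 n w k : (k < n)%N -> w n = w k \/ w n = - w k -> detN n w = 0.
Proof.
move=> lt_kn wn; rewrite /detN -det_tr.
apply: (@determinant_alternate _ _ _ (inord k) ord_max) => [|i].
  by rewrite -val_eqE /= inordK ?ltn_eqF // ltnS ltnW.
have kE : (inord k : 'I_n.+1) = k :> nat by rewrite inordK // ltnS ltnW.
rewrite !mxE ltnn kE lt_kn /lastcol.
have [->|->] := wn; case: ifP => _; rewrite ?sqrrN //.
by rewrite numerNr [sigma2 _ (- _)]sigma2C sigma2N [sigma2 (w k) _]sigma2C.
Qed.

Lemma detsum_root n w x k : (k < n)%N -> x ^+ 2 = w k ^+ 2 -> x != 0 -> x ^+ 2 != 1 ->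
  (forall j, (j < n)%N -> sigma2 (w j) (w k) != 0) -> detsum n w x = 0.
Proof.
move=> lt_kn /eqP; rewrite eqf_sqr => xwk x0 x1 g0.
(* [detsum] does not read slot [n]; filling it with [x] allows a return to genuine determinants,
   which then have two equal columns. *)
pose w' i := if (i < n)%N then w i else x.
have -> : detsum n w x = detsum n w' x.
  by apply: detsum_sign => i lt_in; left; rewrite /w' lt_in.
have w'n : w' n = x by rewrite /w' ltnn.
have w'x : w' n = w' k \/ w' n = - w' k.
  by rewrite w'n /w' lt_kn; case/orP: xwk => /eqP; [left | right].
rewrite -w'n detsum_detN w'n // => [|j lt_jn].
  rewrite !(@detN_eq0 _ _ k) ?mulr0 ?addr0 ?mulr0 //.
  by rewrite /comp; case: w'x => ->; [left | right; rewrite invrN].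
rewrite /w' lt_jn sigma2C; case/orP: xwk => /eqP ->; rewrite ?sigma2N sigma2C; exact: g0.
Qed.

Lemma laurent_sigma2 u : laurent 2 4 (sigma2 u).
Proof.
by apply: laurentM (laurent_sigma (q ^+ 2 * u)) (laurent_sigmaV (q ^+ 2 * u^-1)).
Qed.

Lemma laurent_others n w i : (i < n)%N ->
  laurent (2 * n.-1) (4 * n.-1) (fun x => others n w x i).
Proof.
move=> lt_in.
have := laurent_prod (index_enum 'I_n) (fun j : 'I_n => j != i :> nat)
  (fun j : 'I_n => laurent_sigma2 (w j)).
rewrite -sum1_count sum1_card.
have -> : #|[pred j : 'I_n | j != i :> nat]| = n.-1.
  by rewrite -[n in RHS]card_ord -(cardC1 (Ordinal lt_in)); apply: eq_card.
by rewrite ![(n.-1 * _)%N]mulnC.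
Qed.

Lemma laurent_prod_sigma2 n w :
  laurent (2 * n) (4 * n) (fun x => \prod_(j < n) sigma2 (w j) x).
Proof.
have := laurent_prod (index_enum 'I_n) predT (fun j : 'I_n => laurent_sigma2 (w j)).
by rewrite -sum1_count sum1_card cardT size_enum_ord ![(n * _)%N]mulnC.
Qed.

Lemma laurent_numer u : laurent 2 2 (fun x => numer u x).
Proof.
have lV2 := laurentM (laurentV K) (laurentV K).
have lC : laurent 2 2 (fun=> q ^+ 2 + q^-1 ^+ 2 + u ^+ 2).
  by apply: laurent_weaken (laurentC _) _ _.
have lV : laurent 2 2 (fun x : K => x^-1 * x^-1).
  by apply: laurent_weaken lV2 _ _.
exact: laurentD lC lV.
Qed.

Lemma laurent_numerV u : laurent 0 2 (fun x => numer u x^-1).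
Proof.
have lC : laurent 0 2 (fun=> q ^+ 2 + q^-1 ^+ 2 + u ^+ 2).
  by apply: laurent_weaken (laurentC _) _ _.
apply: eq_laurent (laurentD lC (laurentM (laurentX K) (laurentX K))) => x _.
by rewrite /numer invrK.
Qed.

(** Up to constants, the coefficients of the cofactors have exponents in [-2, 1] for the first
    matrix and [-1, 2] for the second, and each of the [n.-1] remaining factors [sigma2] in
    [-2, 2]. *)
Lemma laurent_detsum n w : laurent (2 * n) (4 * n) (detsum n w).
Proof.
have l1 : laurent 0 1 (fun x : K => x - 1).
  by apply: laurentD (laurentX K) (laurent_weaken (laurentC (-1)) _ _).
have l2 : laurent 1 1 (fun x : K => x^-1 - 1).
  by apply: laurentD (laurent_weaken (laurentV K) _ _)
       (laurent_weaken (laurentC (-1)) _ _).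
have lem (i : 'I_n) a b : laurent (2 * n) (4 * n) (fun x =>
    ((x - 1) * numer (w i) x * a + (x^-1 - 1) * numer (w i)^-1 x^-1 * b)
    * others n w x i).
  have n0 := leq_ltn_trans (leq0n i) (ltn_ord i).
  have -> : (2 * n = 2 + 2 * n.-1)%N by lia.
  have -> : (4 * n = 4 + 4 * n.-1)%N by lia.
  apply: laurentM (laurent_others w (ltn_ord i)).
  apply: laurentD.
    have l := laurentM (laurentM l1 (laurent_numer (w i))) (laurentC a).
    by apply: laurent_weaken l _ _.
  have l := laurentM (laurentM l2 (laurent_numerV (w i)^-1)) (laurentC b).
  by apply: laurent_weaken l _ _.
have lG : laurent (2 * n) (4 * n)
    (fun x => (\prod_(j < n) sigma2 (w j) x) * cof n w ord_max).
  have := laurentM (laurent_prod_sigma2 n w) (laurentC (cof n w ord_max)).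
  by rewrite !addn0.
have lS := laurent_sum (index_enum 'I_n) predT (fun i : 'I_n =>
  lem i (cof n w (widen_ord (leqnSn n) i))
    (cof n (GRing.inv \o w) (widen_ord (leqnSn n) i))).
by apply: eq_laurent (laurentD lS lG) => x _; rewrite detsum_expand.
Qed.

Lemma sigma_neq0 (a : K) : a != 0 -> a ^+ 2 != 1 -> sigma a != 0.
Proof.
move=> a0 a2; have -> : sigma a = (a ^+ 2 - 1) / a by rewrite /sigma; field.
by rewrite mulf_neq0 ?invr_eq0 // subr_eq0.
Qed.

End Determinants.

(** * The identity to be interpolated, and its genericity conditions *)

Section Identity.
Implicit Types (u v k x : K) (us vs l : seq K) (n : nat).

Definition corner_factor u := sigma u * sigma (q * u) * sigma (q * u^-1).

Definition pair_weight u v := (sigma2 u v / sigma (u * v^-1)) ^+ 2.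

Fixpoint pairs us :=
  if us is u :: us' then (\prod_(v <- us') pair_weight u v) * pairs us' else 1.

Definition normalization n :=
  sigma (q ^+ 2) ^+ n / (sigma q ^+ (2 * n) * sigma (q ^+ 4) ^+ (n ^ 2)).

Definition detsum_seq us x := detsum (size us) (nth 0 us) x.

(* The theorem with central parameter [x], cleared of the denominators that
   involve [x]. *)
Definition dasasm_identity us x :=
  topsum us x all_up * \prod_(u <- us) sigma (u * x^-1)
  = normalization (size us) * (\prod_(u <- us) corner_factor u) * pairs us
    * detsum_seq us x.

(* [sigma (q ^+ 4 * u / v)] is the weight, up to a factor, of the crossing that
   exchanges two paths; the other conditions keep the interpolation points
   distinct. *)
Definition generic us := [/\ uniq us, {in us, forall u, u != 0 /\ u ^+ 2 != 1},
  {in us &, forall u v, sigma2 u v != 0} &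
  {in us &, forall u v, u != v -> u ^+ 2 != v ^+ 2 /\ sigma (q ^+ 4 * u / v) != 0}].

Lemma sigmaV x : sigma x^-1 = - sigma x.
Proof. by rewrite /sigma invrK opprB. Qed.

Lemma pair_weightC u v : pair_weight u v = pair_weight v u.
Proof.
have uvE : u * v^-1 = (v * u^-1)^-1 by rewrite invfM invrK mulrC.
by rewrite /pair_weight uvE sigmaV invrN mulrN sqrrN sigma2C.
Qed.

Lemma pairs_front l u us : pairs (l ++ u :: us) = pairs (u :: l ++ us).
Proof.
elim: l => //= v l ->.
rewrite !big_cat !big_cons /= !big_cat /= [pair_weight v u]pair_weightC.
by ring.
Qed.

Lemma detsum_seq_perm us us' x : perm_eq us us' -> detsum_seq us x = detsum_seq us' x.
Proof.
move=> eq_us; have := perm_size eq_us; rewrite /detsum_seq => eq_size.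
rewrite -eq_size; set n := size us.
have sz : size us' == n by rewrite -eq_size.
have /tuple_permP [p pE] : perm_eq us (Tuple sz) by [].
apply: (@detsum_perm n p) => i.
by rewrite {1}pE -tnth_nth tnth_mktuple (tnth_nth 0).
Qed.

Lemma generic_perm us us' : perm_eq us us' -> generic us -> generic us'.
Proof.
move=> eq_us [u1 u2 u3 u4]; have mem_us := perm_mem eq_us.
split; first by rewrite -(perm_uniq eq_us).
- by move=> u; rewrite -mem_us; apply: u2.
- by move=> u v; rewrite -!mem_us; apply: u3.
by move=> u v; rewrite -!mem_us; apply: u4.
Qed.

Lemma generic_behead u us : generic (u :: us) -> generic us.
Proof.
have sub v : v \in us -> v \in u :: us by rewrite inE orbC => ->.
case=> /= /andP [_ u1] u2 u3 u4; split=> //.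
- by move=> v /sub; apply: u2.
- by move=> v w /sub vs /sub; apply: u3.
by move=> v w /sub vs /sub; apply: u4.
Qed.

Lemma generic_neq0 us : generic us -> 0 \notin us.
Proof. by case=> _ u2 _ _; apply/negP => /u2 [/eqP]. Qed.

(** Turns the conditions on [sigma] into inequalities between monomials without denominators, which
    can be tested on polynomials. *)
Lemma generic_monomials (us : seq K) : q != 0 -> uniq us ->
  {in us, forall u, u != 0 /\ u ^+ 2 != 1} ->
  {in us &, forall u v, (q ^+ 2 * u * v) ^+ 2 != 1 /\ q ^+ 4 != (u * v) ^+ 2} ->
  {in us &, forall u v, u != v -> u ^+ 2 != v ^+ 2 /\ (q ^+ 4 * u) ^+ 2 != v ^+ 2} ->
  generic us.
Proof.
move=> q0 uniq_us u2 u3 u4.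
have nz u : u \in us -> u != 0 by case/u2.
split=> // u v uus vus; have [u0 v0] := (nz _ uus, nz _ vus).
  have [quv1 quv2] := u3 _ _ uus vus.
  rewrite mulf_neq0 // sigma_neq0 ?mulf_neq0 ?invr_eq0 ?expf_neq0 //.
  apply: contra quv2 => /eqP quv; rewrite -subr_eq0.
  have -> : q ^+ 4 - (u * v) ^+ 2 = ((q ^+ 2 / u / v) ^+ 2 - 1) * (u * v) ^+ 2.
    by field; rewrite u0 v0.
  by rewrite quv subrr mul0r.
move=> /(u4 _ _ uus vus) [uv quv]; split=> //.
rewrite sigma_neq0 ?mulf_neq0 ?invr_eq0 ?expf_neq0 //.
by rewrite expr_div_n; apply: contra quv => /eqP /divr1_eq ->.
Qed.

End Identity.

Lemma det_matM n (u : nat -> K) :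
  \det (matM n q u) = (u n.+1 - 1) * detN n (fun i => u i.+1).
Proof.
pose d : 'rV[K]_n.+1 := \row_i if (i < n)%N then 1 else u n.+1 - 1.
have -> : matM n q u
    = diag_mx d *m colmx n (fun i => u i.+1) (lastcol n (fun i => u i.+1)).
  apply/matrixP => i j; rewrite mul_diag_mx !mxE /lastcol.
  have [lt_j|le_j] := ltnP j n; first by case: ifP => _; rewrite ?mul1r.
  have -> : j = n :> nat by apply/eqP; rewrite eqn_leq le_j -ltnS ltn_ord.
  by case: ifP => _; rewrite ?mul1r.
rewrite det_mulmx det_diag big_ord_recr /= big1 => [|i _]; rewrite !mxE /= ?ltn_ord //.
by rewrite ltnn mul1r.
Qed.

Lemma matM'_inv n (u : nat -> K) : matM' n q u = matM n q (fun i => (u i)^-1).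
Proof.
apply/matrixP => i j; rewrite !mxE; case: ifP => // _.
by rewrite !invrK; congr (_ / _); rewrite mulrC.
Qed.

Lemma prod_pairs (u : nat -> K) n k : (0 < k <= n.+1)%N ->
  pairs (map u (iota k (n.+1 - k)))
  = \prod_(k <= i < n.+1) \prod_(i.+1 <= j < n.+1) pair_weight (u i) (u j).
Proof.
move=> /andP [k0 le_kn]; move Ed: (n.+1 - k)%N => d.
elim: d k k0 le_kn Ed => [|d IH] k k0 le_kn Ed.
  by rewrite big_geq //; lia.
rewrite big_ltn; last by lia.
rewrite -IH //; [|lia|lia].
rewrite /= big_map /index_iota; congr (\big[_/_]_(_ <- iota _ _) _ * _); lia.
Qed.

Hypotheses (q0 : q != 0) (s1 : sigma q != 0) (s4 : sigma (q ^+ 4) != 0).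

(** * The Yang-Baxter and reflection equations *)

Section YangBaxter.
Implicit Types (f g : state -> K) (s : state) (u v w z : K).

Lemma expr8_neq1 : (q * q) ^+ 4 - 1 != 0.
Proof.
apply: contra s4 => /eqP q8; rewrite /sigma.
have -> : q ^+ 4 - (q ^+ 4)^-1 = ((q * q) ^+ 4 - 1) / q ^+ 4 by field.
by rewrite q8 mul0r.
Qed.

Lemma expr2_neq1 : q * q - 1 != 0.
Proof.
apply: contra s1 => /eqP q2; rewrite /sigma.
have -> : q - q^-1 = (q * q - 1) / q by field.
by rewrite q2 mul0r.
Qed.

(** For $u=q^2a$ and $v=q^2b$ the middle parameter is $q^2ab$, the usual multiplicative form. Only
    three adjacent strands are involved, so the eight orientations are checked one by one. *)
Lemma yang_baxter j u v f : u != 0 -> v != 0 ->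
  cross j u (cross j.+1 (u * v / q ^+ 2) (cross j v f))
  = cross j.+1 v (cross j (u * v / q ^+ 2) (cross j.+1 u f)).
Proof.
move=> u0 v0; apply: (@loc3_ext j) => s.
rewrite !(loc3_R12, loc3_R23); move: (loc3 j f s) => F.
do 3![apply: functional_extensionality => -[]];
  rewrite /R12 /R23 /= /weight_a /weight_b /sigma; field;
  by rewrite u0 v0 q0 expr8_neq1.
Qed.

Definition K2 (a : K) (F : bool -> bool -> K) (x y : bool) :=
  F x y + a * F x (~~ y).
Definition R2 (a b : K) (F : bool -> bool -> K) (x y : bool) :=
  if x == y then a * F x y else F x y + b * F y x.

Definition loc2 j f s (x y : bool) := f (upd (upd s j x) j.+1 y).

Lemma loc2_R2 j u f s :
  loc2 j (cross j u f) s = R2 (weight_a u) (weight_b u) (loc2 j f s).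
Proof.
do 2![apply: functional_extensionality => ?]; rewrite /loc2 /cross /R2.
rewrite !(upd1, upd2, updE).
case: eqP => // _; congr (_ + _ * f _).
by state_eq.
Qed.

Lemma loc2_K2 j u f s :
  loc2 j (bounce j.+1 u f) s = K2 (weight_bounce u) (loc2 j f s).
Proof.
do 2![apply: functional_extensionality => ?]; rewrite /loc2 /bounce /K2.
by rewrite updE upd_upd.
Qed.

Lemma loc2_ext j f g : (forall s, loc2 j f s = loc2 j g s) -> f = g.
Proof.
move=> eqfg; apply: functional_extensionality => s.
have /(congr1 (fun F => F (s j) (s j.+1))) := eqfg s.
by rewrite /loc2 !upd_id.
Qed.

Lemma reflection_right j u v f : u != 0 -> v != 0 ->
  bounce j.+1 u (cross j (u * v) (bounce j.+1 v (cross j (q ^+ 2 * v / u) f)))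
  = cross j (q ^+ 2 * v / u) (bounce j.+1 v (cross j (u * v) (bounce j.+1 u f))).
Proof.
move=> u0 v0; apply: (@loc2_ext j) => s.
rewrite !(loc2_R2, loc2_K2); move: (loc2 j f s) => F.
do 2![apply: functional_extensionality => -[]];
  rewrite /R2 /K2 /= /weight_a /weight_b /weight_bounce /sigma; field;
  by rewrite u0 v0 q0 expr8_neq1 expr2_neq1.
Qed.

Definition loc4 f s (x0 x1 x2 x3 : bool) :=
  f (fun k => match k with
     | 0 => x0 | 1 => x1 | 2 => x2 | 3 => x3 | _ => s k end).

(** All changes take place in the first four positions, which the two corners forget; both sides are
    thus multiples of one value of [f], which leaves sixteen scalar identities. *)
Lemma reflection_left u v f : u != 0 -> v != 0 ->
  cross 0 (q ^+ 2 * v / u) (cross 1 (u * v) (corner u (corner v f)))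
  = cross 2 (q ^+ 2 * v / u) (cross 1 (u * v) (corner v (corner u f))).
Proof.
move=> u0 v0; apply: functional_extensionality => s.
have loc4E g : g s = loc4 g s (s 0) (s 1) (s 2) (s 3).
  by congr g; apply: functional_extensionality => -[|[|[|[|]]]].
have loc4R0 w g x0 x1 x2 x3 : loc4 (cross 0 w g) s x0 x1 x2 x3 =
    if x0 == x1 then weight_a w * loc4 g s x0 x1 x2 x3
    else loc4 g s x0 x1 x2 x3 + weight_b w * loc4 g s x1 x0 x2 x3.
  rewrite /loc4 /cross; case: eqP => // _; congr (_ + _ * g _).
  by apply: functional_extensionality => -[|[|[|[|]]]].
have loc4R1 w g x0 x1 x2 x3 : loc4 (cross 1 w g) s x0 x1 x2 x3 =
    if x1 == x2 then weight_a w * loc4 g s x0 x1 x2 x3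
    else loc4 g s x0 x1 x2 x3 + weight_b w * loc4 g s x0 x2 x1 x3.
  rewrite /loc4 /cross; case: eqP => // _; congr (_ + _ * g _).
  by apply: functional_extensionality => -[|[|[|[|]]]].
have loc4R2 w g x0 x1 x2 x3 : loc4 (cross 2 w g) s x0 x1 x2 x3 =
    if x2 == x3 then weight_a w * loc4 g s x0 x1 x2 x3
    else loc4 g s x0 x1 x2 x3 + weight_b w * loc4 g s x0 x1 x3 x2.
  rewrite /loc4 /cross; case: eqP => // _; congr (_ + _ * g _).
  by apply: functional_extensionality => -[|[|[|[|]]]].
have loc4c x y x0 x1 x2 x3 : loc4 (corner x (corner y f)) s x0 x1 x2 x3 =
    (if x0 == x1 then weight_bounce x^-1 else 1)
    * ((if x2 == x3 then weight_bounce y^-1 else 1) * f (del 0 (del 0 s))).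
  by rewrite /loc4 !cornerE.
rewrite [LHS]loc4E [RHS]loc4E.
rewrite !loc4R0 !loc4R2 !loc4R1 !loc4c; move: (f _) => t.
case: (s 0) (s 1%N) (s 2%N) (s 3%N) => -[] [] []; rewrite /=;
  rewrite /weight_a /weight_b /weight_bounce /sigma; field;
  by rewrite u0 v0 q0 expr8_neq1 ?expr2_neq1 ?oner_eq0.
Qed.

(* The Yang-Baxter equation, repeated along two parallel lines. *)
Lemma braid_pair p y z vs f : y != 0 -> z != 0 -> 0 \notin vs ->
  sweep p (map ( *%R y) vs) (sweep p.+1 (map ( *%R z) vs) (cross p (q ^+ 2 * z / y) f))
  = cross (p + size vs) (q ^+ 2 * z / y)
      (sweep p (map ( *%R z) vs) (sweep p.+1 (map ( *%R y) vs) f)).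
Proof.
move=> y0 z0; elim: vs p f => [|v vs IH] p f /=; first by rewrite addn0.
rewrite inE negb_or eq_sym => /andP [v0 vs0].
(* [z * v] is exactly the middle parameter when the outer ones are [y * v] and [q ^+ 2 * z / y]. *)
rewrite cross_sweep ?ltnSn // -[z * v](_ : y * v * (q ^+ 2 * z / y) / q ^+ 2 = _).
  rewrite yang_baxter ?mulf_neq0 ?invr_eq0 ?expf_neq0 // IH // addSnnS; congr cross.
  by rewrite [in RHS]cross_sweep ?ltnSn.
by field; rewrite y0 q0.
Qed.

End YangBaxter.

(** * Exchanging two neighbouring paths *)

Section Exchange.
Implicit Types (f g : state -> K) (s : state) (a b u v w x z : K) (us l : seq K).

(** Yang-Baxter at the two columns where the row meets the crossed strands. Above the row positions
    are shifted by one, by the edge over the left boundary vertex. *)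
Lemma row_op_cross w l1 a b l2 f : a != 0 -> b != 0 ->
  row_op w (l1 ++ a :: b :: l2) (cross (size l1) (q ^+ 2 * a / b) f)
  = cross (size l1).+1 (q ^+ 2 * a / b) (row_op w (l1 ++ b :: a :: l2) f).
Proof.
move=> a0 b0; rewrite /row_op !size_cat /= corner_cross cross_bounce; last lia.
congr bounce; rewrite !sweep_cat /= add1n -[in LHS](@cross_sweep _ 1%N); last lia.
rewrite [in RHS]cross_sweep; last lia.
congr sweep; move: (sweep _ _ _) => {}f.
have Ea : q ^+ 2 * a / b * b / q ^+ 2 = a by field; rewrite b0 q0.
by rewrite -[X in cross _ X (cross _ b f)]Ea yang_baxter ?Ea ?mulf_neq0 ?invr_eq0 ?expf_neq0.
Qed.

(** A crossing attached at the left ends of [u] and [v] passes down through the rows of [l], through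
    the left reflection, along both lines and through the right reflection, then up again to their
    right ends. *)
Lemma topsum_swap l u v us x : 0 \notin l ++ u :: v :: x :: us ->
  let z := q ^+ 2 * v / u in
  cross (size l) z (topsum (l ++ u :: v :: us) x)
  = cross (size l + (size us).*2.+3) z (topsum (l ++ v :: u :: us) x).
Proof.
move=> + z; elim: l => [|w l IH].
  rewrite !cat0s !in_cons !negb_or !(eq_sym 0) => /and4P [u0 v0 x0 us0].
  have m0 : 0 \notin pal us x.
    by rewrite mem_cat inE mem_rev !negb_or eq_sym x0 us0.
  rewrite !topsum_cons !pal_cons !row_op_row_op ?size_pal //.
  rewrite add0n (@cross_bounce 0%N) // (@cross_comm 0%N) // (@cross_bounce 0%N) //.
  rewrite !(@cross_sweep 0%N) //.
  rewrite reflection_left // braid_pair // add2n size_pal.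
  by rewrite reflection_right // [v * u]mulrC.
rewrite cat_cons in_cons negb_or eq_sym => /andP [w0 l0].
have := l0; rewrite mem_cat !inE !negb_or !(eq_sym 0) => /and5P [_ u0 v0 _ _].
rewrite !cat_cons !topsum_cons.
have palE a b : map ( *%R w) (pal (l ++ a :: b :: us) x)
    = map ( *%R w) l ++ w * a :: w * b ::
      map ( *%R w) (pal us x) ++ w * b :: w * a :: map ( *%R w) (rev l).
  rewrite /pal rev_cat !rev_cons -!cats1 -!catA /= !map_cat /= !map_cat /=.
  by rewrite map_cat /= -catA.
have zE : z = q ^+ 2 * (w * v) / (w * u) by rewrite /z; field; rewrite w0 u0.
rewrite !palE zE -[size (w :: l)]/(size l).+1.
rewrite -[X in cross X.+1 _ _](size_map ( *%R w)) -row_op_cross ?mulf_neq0 //.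
rewrite size_map -zE IH //.
set k := (_ + _)%N; rewrite zE.
have catE (a b c d : K) (l1 l2 l3 : seq K) :
  l1 ++ a :: b :: l2 ++ c :: d :: l3 = (l1 ++ a :: b :: l2) ++ c :: d :: l3.
  by rewrite -catA.
rewrite !catE addSn -/k.
have <- : size (map ( *%R w) l ++ w * v :: w * u :: map ( *%R w) (pal us x)) = k.
  by rewrite size_cat /= !size_map size_pal /k; lia.
by rewrite row_op_cross ?mulf_neq0.
Qed.

End Exchange.

(** * The recursion at $u_i u_{n+1}=q^2$ *)

Section Descent.
Implicit Types (f g : state -> K) (s : state) (a b c u v w x y z : K) (us vs l : seq K).

(** With all edges up, the auxiliary crossing multiplies both sides by the same [weight_a]. *)
Lemma topsum_all_up_swap l u v us x : 0 \notin l ++ u :: v :: x :: us ->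
  weight_a (q ^+ 2 * v / u) != 0 ->
  topsum (l ++ u :: v :: us) x all_up = topsum (l ++ v :: u :: us) x all_up.
Proof.
move=> nz0 /mulfI; apply.
have /(congr1 (fun f => f all_up)) := topsum_swap nz0.
by rewrite /cross.
Qed.

Lemma topsum_all_up_front l u us x : 0 \notin l ++ u :: x :: us ->
  {in l, forall v, weight_a (q ^+ 2 * u / v) != 0} ->
  topsum (l ++ u :: us) x all_up = topsum (u :: l ++ us) x all_up.
Proof.
elim/last_ind: l us => [|l v IH] us //.
rewrite !cat_rcons => nz0 gen_l.
rewrite topsum_all_up_swap; first last.
- by apply: gen_l; rewrite mem_rcons mem_head.
- move: nz0; rewrite !(mem_cat, inE) !negb_or.
  by case/andP=> -> /and4P [-> -> -> ->].
rewrite IH // => [|w lw]; last by apply: gen_l; rewrite mem_rcons inE lw orbT.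
move: nz0; rewrite !(mem_cat, inE) !negb_or.
by case/andP=> -> /and4P [-> -> -> ->].
Qed.

Lemma cross_q2 j f : cross j (q ^+ 2) f = f.
Proof.
apply: functional_extensionality => s; rewrite /cross /weight_a /weight_b.
have -> : q ^+ 2 * q ^+ 2 = q ^+ 4 by ring.
rewrite divff // mul1r divff ?expf_neq0 // {1}/sigma invr1 subrr !mul0r addr0.
by case: ifP.
Qed.

(* The line with parameter [y] that starts as the central column and ends by
   turning to the right of all paths is pulled until it turns below them. *)
Lemma topsum_descent y vs : y != 0 -> 0 \notin vs ->
  bounce (size vs).*2 y (sweep (size vs) (map ( *%R y) (rev vs)) (topsum vs (q ^+ 2 / y)))
  = scale (1 + weight_bounce y)
      (sweep (size vs) (map ( *%R (q ^+ 2 / y)) (rev vs)) (topsum vs y)).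
Proof.
move=> y0; set x := q ^+ 2 / y.
have x0 : x != 0 by rewrite mulf_neq0 ?invr_eq0 ?expf_neq0.
elim: vs => [_|v vs IH]; rewrite ?in_cons ?negb_or.
  (* With no path left the line turns at the free bottom edge; summing over its two orientations
     gives the factor [1 + weight_bounce y]. *)
  by apply: functional_extensionality => s; rewrite /= /bounce /scale !mulr1.
rewrite eq_sym => /andP [v0 vs0]; have r0 : 0 \notin rev vs by rewrite mem_rev.
set m := size vs; set r := rev vs.
have sr : size r = m by rewrite size_rev.
have TE t : row_op v (map ( *%R v) (pal vs t)) (topsum vs t) = bounce m.*2.+2 v
    (sweep m.+2 (map ( *%R v) r) (cross m.+1 (v * t)
      (sweep 1 (map ( *%R v) vs) (corner v (topsum vs t))))).
  rewrite /row_op size_map size_pal /pal map_cat sweep_cat size_map /=.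
  by rewrite add1n.
rewrite !topsum_cons !TE rev_cons -cats1 -/r !map_cat !sweep_cat !size_map sr /=.
rewrite -/m -[(m.+1 + m)%N]/(m + m).+1 addnn.
rewrite doubleS -!(@bounce_sweep _ m.+1) ?size_map ?sr -?addnn ?addSn ?ltnSn ?orbT //.
rewrite ?addnn.
(* Because [x * y = q ^+ 2], the crossing of path [v] with the central column is the one that
   exchanges the lines [v] and [y], so it can be braided to the right end and reflected there. *)
have -> : v * x = q ^+ 2 * v / y by rewrite /x; field.
rewrite braid_pair // sr addSn addnn reflection_right //.
rewrite [q ^+ 2 * v / y](_ : _ = x * v); last by rewrite /x; field.
rewrite -cross_scale -bounce_scale; congr (cross _ _ (bounce _ _ _)).
have -> : v * y = q ^+ 2 * v / x by rewrite /x; field; rewrite q0 y0.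
rewrite braid_pair // sr addSn addnn -cross_scale -sweep_scale.
have -> : q ^+ 2 * v / x = y * v by rewrite /x; field; rewrite q0 y0.
congr (cross _ _ _).
rewrite bounce_sweep ?size_map ?sr; last lia.
congr (sweep _ _ _).
rewrite -!(@sweep_sweep 1%N (map ( *%R v) vs)) ?size_map ?add1n //.
rewrite bounce_sweep; last by (rewrite size_map -/m; lia).
rewrite -sweep_scale; congr (sweep _ _ _).
by rewrite -!corner_sweep -corner_bounce IH // corner_scale.
Qed.

(** With the central crossing trivial, the right half of path [u] continues into the lower central
    column and can be pulled down. What remains beside [topsum vs u] has all its edges up: the left
    half with parameter [u], the pulled line with [q ^+ 2 / u], and the corner. *)
Lemma topsum_all_up_rec u vs : u != 0 -> 0 \notin vs ->
  topsum (u :: vs) (q ^+ 2 / u) all_up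
  = weight_bounce u^-1 * (1 + weight_bounce u)
    * \prod_(v <- vs) (weight_a (u * v) * weight_a (q ^+ 2 / u * v)) * topsum vs u all_up.
Proof.
move=> u0 vs0; rewrite topsum_cons /row_op size_map size_pal /pal map_cat sweep_cat /=.
have -> : u * (q ^+ 2 / u) = q ^+ 2 by field.
rewrite cross_q2 !size_map !add1n.
rewrite -(@sweep_sweep 1%N (map ( *%R u) vs)) ?size_map ?add1n //.
rewrite bounce_sweep ?size_map ?add1n ?ltnS -?addnn ?leq_addr ?orbT // ?addnn.
rewrite -corner_sweep -corner_bounce topsum_descent // corner_scale sweep_scale /scale.
rewrite sweep_all_up big_map cornerE /= sweep_all_up map_rev big_rev big_map.
by rewrite [in RHS]big_split /=; ring.
Qed.

End Descent.

(** * Induction on the number of paths by interpolation *)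

Section Interpolation.
Implicit Types (u v k x : K) (us vs l : seq K) (n : nat).

Lemma identity_front l u us x : generic (u :: l ++ us) -> x != 0 ->
  dasasm_identity (u :: l ++ us) x -> dasasm_identity (l ++ u :: us) x.
Proof.
move=> gen x0; have perm_us : perm_eq (l ++ u :: us) (u :: l ++ us).
  by rewrite -cat1s perm_catCA.
rewrite /dasasm_identity (detsum_seq_perm _ perm_us) (perm_size perm_us) pairs_front.
rewrite !(perm_big _ perm_us) /= topsum_all_up_front //.
  have := generic_neq0 gen; rewrite !(inE, mem_cat) !negb_or [0 == x]eq_sym x0.
  by case/and3P => -> -> ->.
case: gen => uniq_us _ _ u4 v vl; rewrite /weight_a mulf_neq0 ?invr_eq0 //.
have -> : q ^+ 2 * (q ^+ 2 * u / v) = q ^+ 4 * u / v by ring.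
have uv : u != v by apply: contraTneq uniq_us => ->; rewrite /= mem_cat vl.
have [] // := u4 u v _ _ uv; first by rewrite mem_head.
by rewrite inE mem_cat vl orbT.
Qed.

(** The same two determinants [d] and [d'] occur for both sizes, which is what makes the recursions
    on the two sides comparable. *)
Lemma detsum_seq_last vs k x : sigma2 k x = 0 -> k != 0 -> k ^+ 2 != 1 ->
  {in vs, forall v, sigma2 v k != 0} -> exists d d',
  detsum_seq (k :: vs) x = - (\prod_(v <- vs) sigma2 v x)
    * ((x - 1) * numer k x * d + (x^-1 - 1) * numer k^-1 x^-1 * d') /\
  detsum_seq vs k = (\prod_(v <- vs) sigma2 v k) * ((k - 1) * d + (k^-1 - 1) * d').
Proof.
move=> g0 k0 k1 gk; set w := nth 0 (rcons vs k).
have wk : w (size vs) = k by rewrite /w nth_rcons ltnn eqxx.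
have wv j : (j < size vs)%N -> w j = nth 0 vs j by move=> lt_j; rewrite /w nth_rcons lt_j.
exists (detN (size vs) w), (detN (size vs) (GRing.inv \o w)).
have prodE y : \prod_(j < size vs) sigma2 (w j) y = \prod_(v <- vs) sigma2 v y.
  by rewrite (big_nth 0) big_mkord; apply: eq_bigr => j _; rewrite wv.
split.
  have -> : detsum_seq (k :: vs) x = detsum_seq (rcons vs k) x.
    by apply: detsum_seq_perm; rewrite perm_sym perm_rcons.
  by rewrite /detsum_seq size_rcons -/w detsum_penult ?wk // prodE.
have -> : detsum_seq vs k = detsum (size vs) w (w (size vs)).
  by rewrite wk; apply: detsum_sign => j lt_j; left; rewrite wv.
rewrite detsum_detN wk ?prodE // => j lt_j.
by rewrite wv //; apply: gk; apply: mem_nth.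
Qed.

(** Since $(n+1)^2=n^2+2n+1$, the excess $\sigma(q^4)^{2n}$ accounts for the denominators of the
    $2n$ weights in the recursion. *)
Lemma normalizationS n : sigma (q ^+ 4) ^+ n ^+ 2 * normalization n.+1
  = normalization n * (sigma (q ^+ 2) / (sigma q ^+ 2 * sigma (q ^+ 4))).
Proof.
rewrite /normalization mulnS.
have -> : (n.+1 ^ 2 = n * 2 + n ^ 2 + 1)%N by rewrite !expnS; lia.
rewrite !exprD exprM [sigma (q ^+ 2) ^+ n.+1]exprS expr1.
have := expf_neq0 n s4; have := expf_neq0 (n ^ 2) s4.
move: (sigma (q ^+ 4) ^+ n) (sigma (q ^+ 4) ^+ (n ^ 2)) => a b b0 a0.
by field; rewrite a0 b0 s1 s4 ?expf_neq0.
Qed.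

Lemma identity_descent k vs : generic (k :: vs) ->
  dasasm_identity vs k -> dasasm_identity (k :: vs) (q ^+ 2 / k).
Proof.
move=> gen idvs; set x := q ^+ 2 / k.
have [/= /andP [kvs _] u2 u3 u4] := gen.
have [k0 k1] := u2 _ (mem_head _ _).
have g0 : sigma2 k x = 0.
  rewrite /sigma2 /x [X in _ * X](_ : _ = 0) ?mulr0 // /sigma.
  by field; rewrite ?k0 ?q0 ?oner_eq0.
have [v|d [d' [EL1 EL2]]] := detsum_seq_last g0 k0 k1 (vs := vs).
  by move=> vvs; apply: u3; rewrite ?mem_head // inE vvs orbT.
have v0 v : v \in vs -> v != 0 by move=> vvs; apply: (u2 v _).1; rewrite inE vvs orbT.
have svk v : v \in vs -> sigma (v * k^-1) != 0.
  move=> vvs; have vk : v != k by apply: contraNneq kvs => <-.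
  have [|| vk2 _] := u4 v k _ _ vk; rewrite ?mem_head // ?inE ?vvs ?orbT //.
  apply: contra vk2 => /eqP; rewrite /sigma => svk0; rewrite -subr_eq0.
  have -> : v ^+ 2 - k ^+ 2 = (v / k - (v / k)^-1) * (v * k) by field; rewrite k0 v0.
  by rewrite svk0 mul0r.
have prodk0 : \prod_(v <- vs) sigma (v * k^-1) != 0.
  by rewrite prodf_seq_neq0; apply/allP => v vvs; rewrite svk.
(* The recursion is matched separately for each other path [v], and then, in [global], for the
   factors in [k] alone, as an identity linear in [d] and [d']. *)
have each v : v \in vs ->
    weight_a (k * v) * weight_a (q ^+ 2 / k * v) * sigma (v * x^-1) * sigma2 v k
    / sigma (v * k^-1)
  = (sigma (q ^+ 4))^-1 ^+ 2 * pair_weight k v * sigma2 v x.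
  move=> vvs; rewrite pair_weightC /pair_weight /sigma2 /weight_a /x.
  have -> : v * (q ^+ 2 / k)^-1 = (q ^+ 2 * v^-1 * k^-1)^-1.
    by rewrite !invfM !invrK; ring.
  have -> : q ^+ 2 * v^-1 * (q ^+ 2 / k)^-1 = (v * k^-1)^-1.
    by field; rewrite k0 q0 v0.
  have -> : q ^+ 2 * (q ^+ 2 / k * v) = q ^+ 2 * v * (q ^+ 2 / k) by ring.
  have -> : q ^+ 2 * (k * v) = q ^+ 2 * v * k by ring.
  by rewrite !sigmaV; field; rewrite s4 svk.
have global : weight_bounce k^-1 * (1 + weight_bounce k) * sigma (k * x^-1)
    * ((k - 1) * d + (k^-1 - 1) * d')
  = - (sigma (q ^+ 2) / (sigma q ^+ 2 * sigma (q ^+ 4))) * corner_factor k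
    * ((x - 1) * numer k x * d + (x^-1 - 1) * numer k^-1 x^-1 * d').
  rewrite /weight_bounce /corner_factor /numer /x /sigma; field.
  by rewrite k0 q0 expr8_neq1 expr2_neq1 oner_eq0.
have prods : (\prod_(v <- vs) (weight_a (k * v) * weight_a (q ^+ 2 / k * v)))
    * (\prod_(v <- vs) sigma (v * x^-1)) * (\prod_(v <- vs) sigma2 v k)
    / (\prod_(v <- vs) sigma (v * k^-1))
  = (sigma (q ^+ 4) ^+ size vs ^+ 2)^-1 * (\prod_(v <- vs) pair_weight k v)
    * (\prod_(v <- vs) sigma2 v x).
  rewrite -prodfV -!big_split /= (eq_big_seq _ each).
  set c := _^-1 ^+ 2.
  have -> : (sigma (q ^+ 4) ^+ size vs ^+ 2)^-1 = c ^+ size vs.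
    by rewrite /c -!exprM -exprVn [(2 * _)%N]mulnC.
  rewrite big_split [X in X * _ = _]big_split /=.
  by rewrite big_const_seq count_predT iter_mulr_1.
have topsumE : topsum vs k all_up
  = normalization (size vs) * (\prod_(u <- vs) corner_factor u) * pairs vs
    * ((\prod_(v <- vs) sigma2 v k) * ((k - 1) * d + (k^-1 - 1) * d'))
    / (\prod_(v <- vs) sigma (v * k^-1)).
  by apply/(mulIf prodk0); rewrite mulfVK // idvs EL2.
rewrite /dasasm_identity topsum_all_up_rec //; last first.
  exact: generic_neq0 (generic_behead gen).
rewrite !big_cons [pairs _]/= EL1 -/x topsumE [size _]/=.
have normE : normalization (size vs).+1 = (sigma (q ^+ 4) ^+ size vs ^+ 2)^-1
    * normalization (size vs) * (sigma (q ^+ 2) / (sigma q ^+ 2 * sigma (q ^+ 4))).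
  by rewrite -mulrA -normalizationS mulKf // !expf_neq0.
rewrite normE.
move: prods global.
set P1 := \prod_(v <- vs) (_ * _); set P2 := \prod_(v <- vs) sigma (v * x^-1).
set P3 := \prod_(v <- vs) sigma2 v k; set P4 := \prod_(v <- vs) sigma (v * k^-1).
set Q1 := \prod_(v <- vs) pair_weight k v; set Q2 := \prod_(v <- vs) sigma2 v x.
set B := \prod_(u <- vs) corner_factor u.
set W := weight_bounce k^-1 * (1 + weight_bounce k).
set X := (k - 1) * d + _; set Y := (x - 1) * _ * _ + _.
set a := (_ ^+ 2)^-1; set C := normalization _; set t := _ / (_ * _).
move=> prods global.
transitivity (W * sigma (k * x^-1) * X * (P1 * P2 * P3 / P4) * (C * B * pairs vs)).
  by ring.
by rewrite prods global; ring.
Qed.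

Lemma identity_opp k vs x :
  dasasm_identity (k :: vs) x -> dasasm_identity (- k :: vs) x.
Proof.
rewrite /dasasm_identity topsum_all_upN !big_cons mulNr sigmaN.
rewrite [pairs _]/= [pairs (_ :: _)]/=.
have -> : corner_factor (- k) = - corner_factor k.
  by rewrite /corner_factor invrN !mulrN !sigmaN !mulrN !mulNr opprK.
have -> : \prod_(v <- vs) pair_weight (- k) v = \prod_(v <- vs) pair_weight k v.
  by apply: eq_bigr => v _; rewrite /pair_weight sigma2N mulNr sigmaN invrN mulrN sqrrN.
have -> : detsum_seq (- k :: vs) x = detsum_seq (k :: vs) x.
  by apply: detsum_sign => -[|i] _ /=; [right | left].
by rewrite !mulNr mulrN !mulrN !mulNr => ->.
Qed.

Lemma prod_opp_seq (r : seq K) (F : K -> K) :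
  \prod_(u <- r) - F u = (-1) ^+ size r * \prod_(u <- r) F u.
Proof.
elim: r => [|u r IH]; first by rewrite !big_nil mul1r.
by rewrite !big_cons IH /= exprS; ring.
Qed.

Lemma identity_inv us x :
  dasasm_identity (map GRing.inv us) x^-1 -> dasasm_identity us x.
Proof.
have sigma_div (u v : K) : sigma (u^-1 * v^-1^-1) = - sigma (u * v^-1).
  by rewrite -invfM sigmaV.
rewrite /dasasm_identity topsum_all_up_inv size_map !big_map.
under eq_bigr => u _ do rewrite sigma_div.
have -> : \prod_(u <- us) corner_factor u^-1 = \prod_(u <- us) - corner_factor u.
  apply: eq_bigr => u _; rewrite /corner_factor invrK sigmaV -mulrA.
  by rewrite [sigma (q * u^-1) * _]mulrC mulrA !mulNr.
have -> : pairs (map GRing.inv us) = pairs us.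
  elim: us => //= u us ->; rewrite big_map; congr (_ * _); apply: eq_bigr => v _.
  by rewrite /pair_weight sigma2V sigma_div invrN mulrN sqrrN.
have -> : detsum_seq (map GRing.inv us) x^-1 = detsum_seq us x.
  rewrite /detsum_seq size_map -[RHS]detsum_inv; apply: detsum_sign => i lt_i; left.
  by rewrite (nth_map 0).
rewrite !prod_opp_seq => idus.
have /mulfI : (-1) ^+ size us != 0 :> K by rewrite signr_eq0.
by apply; rewrite mulrCA idus; ring.
Qed.

Lemma generic_opp k vs : generic (k :: vs) -> generic (- k :: vs).
Proof.
case=> /= /andP [kvs uvs] u2 u3 u4.
have [k0 k1] := u2 _ (mem_head _ _).
have sub v : v \in vs -> v \in k :: vs by rewrite inE orbC => ->.
have vk v : v \in vs -> v != k by move=> vvs; apply: contraNneq kvs => <-.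
split.
- rewrite /= uvs andbT; apply/negP => kvs'.
  have [/eqP []] := u4 _ _ (sub _ kvs') (mem_head _ _) (vk _ kvs').
  by rewrite sqrrN.
- by move=> v; rewrite inE => /predU1P [->|/sub /u2 //]; rewrite oppr_eq0 sqrrN.
- have gk v : v \in k :: vs -> sigma2 (- k) v != 0.
    by move=> vvs; rewrite sigma2N u3 ?mem_head.
  move=> u v; rewrite !inE => /predU1P [->|/sub us] /predU1P [->|/sub vvs].
  + by rewrite sigma2N sigma2C sigma2N u3 ?mem_head.
  + exact: gk.
  + by rewrite sigma2C gk.
  + exact: u3.
move=> u v; rewrite !inE => /predU1P [->|us] /predU1P [->|vvs].
- by rewrite eqxx.
- move=> _; rewrite sqrrN mulrN mulNr sigmaN oppr_eq0.
  by apply: u4; rewrite ?mem_head ?sub // eq_sym vk.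
- move=> _; rewrite sqrrN invrN mulrN sigmaN oppr_eq0.
  by apply: u4; rewrite ?mem_head ?sub // vk.
by apply: u4; apply: sub.
Qed.

Lemma generic_inv us : generic us -> generic (map GRing.inv us).
Proof.
case=> u1 u2 u3 u4; split.
- by rewrite map_inj_uniq //; apply: invr_inj.
- move=> _ /mapP [u /u2 [u0 u1'] ->]; rewrite invr_eq0; split=> //.
  by rewrite exprVn -[1]invr1 (inj_eq invr_inj).
- by move=> _ _ /mapP [u uus ->] /mapP [v vus ->]; rewrite sigma2V u3.
move=> _ _ /mapP [u uus ->] /mapP [v vus ->]; rewrite (inj_eq invr_inj) => uv.
rewrite !exprVn (inj_eq invr_inj) invrK.
have [u2v2 _] := u4 _ _ uus vus uv; split=> //.
have vu : v != u by rewrite eq_sym.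
by have [_] := u4 _ _ vus uus vu; rewrite mulrAC.
Qed.

Lemma identity_points n : (forall us x, size us = n -> generic us -> x != 0 ->
    dasasm_identity us x) ->
  forall us k, size us = n.+1 -> generic us -> k \in us ->
  dasasm_identity us (q ^+ 2 / k) /\ dasasm_identity us (- (q ^+ 2 / k)).
Proof.
move=> IH us k + + kus; case/splitPr: kus => l r.
rewrite size_cat /= addnS => -[sz] gen.
have {}gen : generic (k :: l ++ r).
  by apply: generic_perm gen; rewrite -[k :: r]cat1s perm_catCA.
have [_ u2 _ _] := gen; have [k0 _] := u2 _ (mem_head _ _).
have x0 : q ^+ 2 / k != 0 by rewrite mulf_neq0 ?invr_eq0 ?expf_neq0.
have vsP y : y != 0 -> dasasm_identity (l ++ r) y.
  by apply: IH; [rewrite size_cat | apply: generic_behead gen].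
split; apply: identity_front; rewrite ?oppr_eq0 //.
  by apply: identity_descent => //; apply: vsP.
rewrite -[k in k :: _]opprK; apply: identity_opp.
rewrite -mulrN -invrN; apply: identity_descent; first exact: generic_opp.
by apply: vsP; rewrite oppr_eq0.
Qed.

Hypothesis two0 : (2 : K) != 0.

Lemma uniq_map_inj (aT rT : eqType) (f : aT -> rT) (s : seq aT) :
  uniq (map f s) -> {in s &, injective f}.
Proof.
elim: s => //= a s IH /andP [fa uniq_s] x y.
have nfa z : z \in s -> f z != f a.
  by move=> zs; apply: contraNneq fa => <-; apply: map_f.
rewrite !inE => /predU1P [->|xs] /predU1P [->|ys] //.
- by move/eqP; rewrite eq_sym (negbTE (nfa _ ys)).
- by move/eqP; rewrite (negbTE (nfa _ xs)).
exact: IH.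
Qed.

(** Distinct squares separate nodes even up to sign; characteristic other than 2 separates a nonzero
    node from its opposite. *)
Lemma uniq_cat_opp (a : K) (l : seq K) : 0 \notin l ->
  uniq (map (fun r => r ^+ 2) (a :: l)) -> uniq (a :: l ++ map -%R l).
Proof.
move=> l0 /= /andP [a_l uniq_l2].
have inj_l := uniq_map_inj uniq_l2.
have uniq_l : uniq l by apply: map_uniq uniq_l2.
rewrite cat_uniq uniq_l (map_inj_uniq oppr_inj) uniq_l andbT /= mem_cat negb_or.
rewrite -andbA; apply/and3P; split.
- by apply: contra a_l => al; apply: map_f.
- apply: contra a_l => /mapP [r rl ->]; rewrite sqrrN.
  exact: (map_f (fun r : K => r ^+ 2)).
apply/hasPn => _ /mapP [r rl ->] /=; apply/negP => nrl.
have rr : - r = r by apply: inj_l; rewrite // sqrrN.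
have /eqP : 2 * r = 0 by rewrite mulr_natl mulr2n -{1}rr addNr.
rewrite mulf_eq0 (negbTE two0) /= => /eqP r0.
by rewrite r0 (negbTE l0) in rl.
Qed.

Lemma interpolation_nodes u us : generic (u :: us) ->
  let nodes := (u :: us) ++ map (fun k => q ^+ 2 / k) (u :: us) in
  uniq ((q ^+ 2 * u)^-1 :: nodes ++ map -%R nodes) /\ 0 \notin nodes.
Proof.
move=> gen nodes; have us0 := generic_neq0 gen.
have nz k : k \in u :: us -> k != 0 by move=> kus; apply: contraNneq us0 => <-.
have q2 : q ^+ 2 != 0 by rewrite expf_neq0.
have nodes0 : 0 \notin nodes.
  rewrite mem_cat negb_or us0; apply/mapP => -[k /nz k0 /eqP].
  by rewrite eq_sym mulf_eq0 invr_eq0 (negbTE k0) (negbTE q2).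
split=> //; apply: uniq_cat_opp => //.
have [uniq_us u2 u3 u4] := gen.
have gE k v : k \in u :: us -> v \in u :: us ->
    (k * v) ^+ 2 != q ^+ 4 /\ (k * v) ^+ 2 * q ^+ 4 != 1.
  move=> kus vus; have := u3 _ _ kus vus; rewrite /sigma2 mulf_eq0 negb_or.
  have [k0 v0] := (nz _ kus, nz _ vus) => /andP [g1 sigma2]; split.
    apply: contra sigma2 => /eqP kv; rewrite /sigma.
    have -> : q ^+ 2 / k / v - (q ^+ 2 / k / v)^-1
        = (q ^+ 4 - (k * v) ^+ 2) / (k * v * q ^+ 2).
      by field; rewrite k0 v0 q0.
    by rewrite kv subrr mul0r.
  apply: contra g1 => /eqP kv; rewrite /sigma.
  have -> : q ^+ 2 * k * v - (q ^+ 2 * k * v)^-1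
      = ((k * v) ^+ 2 * q ^+ 4 - 1) / (k * v * q ^+ 2).
    by field; rewrite k0 v0 q0.
  by rewrite kv subrr mul0r.
have sq_inj : {in u :: us &, injective (fun k : K => k ^+ 2)}.
  move=> k v kus vus /= /eqP kv; apply/eqP; apply: contraLR kv => kv.
  by have [] := u4 _ _ kus vus kv.
(* Separates the extra node $1/(q^2u)$ from $\pm q^2/u$. *)
have q8 : q ^+ 8 != 1.
  have := expr8_neq1; rewrite subr_eq0; apply: contra => /eqP q8.
  by rewrite -q8; apply/eqP; ring.
rewrite map_cons cons_uniq /nodes !map_cat cat_uniq -!map_comp.
rewrite (map_inj_in_uniq sq_inj) uniq_us map_inj_in_uniq ?uniq_us ?andbT; last first.
  move=> k v kus vus /= /eqP; rewrite !expr_div_n (inj_eq (mulfI _)) ?expf_neq0 //.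
  by rewrite (inj_eq invr_inj) => /eqP; apply: sq_inj.
apply/andP; split.
  rewrite mem_cat negb_or; apply/andP; split; apply/mapP => -[k kus] /=.
    move=> uk; have [_ /eqP []] := gE _ _ (mem_head u us) kus.
    by rewrite exprMn -uk; field; rewrite q0 nz ?mem_head.
  have [k0 u0] := (nz _ kus, nz _ (mem_head u us)).
  move=> uk; have kE : k ^+ 2 = q ^+ 8 * u ^+ 2.
    transitivity (k ^+ 2 * (q ^+ 2 * u) ^+ 2 * (q ^+ 2 * u)^-1 ^+ 2).
      by field; rewrite q0 u0.
    by rewrite uk; field.
  have [ku|ku] := eqVneq u k.
    have := q8; rewrite -subr_eq0; apply/negP; rewrite negbK.
    have -> : q ^+ 8 - 1 = (q ^+ 8 * u ^+ 2 - k ^+ 2) / k ^+ 2 by rewrite ku; field.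
    by rewrite kE subrr mul0r.
  have [_] := u4 _ _ (mem_head u us) kus ku; apply/negP; rewrite negbK /sigma.
  have -> : q ^+ 4 * u / k - (q ^+ 4 * u / k)^-1
      = (q ^+ 8 * u ^+ 2 - k ^+ 2) / (q ^+ 4 * u * k) by field; rewrite k0 u0 q0.
  by rewrite kE subrr mul0r.
rewrite andTb; apply/hasPn => _ /mapP [k kus ->]; apply/mapP => -[v vus] /= kv.
have [/eqP kvN _] := gE _ _ kus vus; apply: kvN.
by rewrite exprMn -kv; field; apply: nz.
Qed.

Lemma laurent_prod_sigma us : laurent (size us) (size us).*2
  (fun x => \prod_(u <- us) sigma (u * x^-1)).
Proof.
have := laurent_prod us predT (fun u : K => laurent_sigmaV u).
by rewrite count_predT muln1 muln2.
Qed.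

Theorem dasasm_identity_generic us x : generic us -> x != 0 -> dasasm_identity us x.
Proof.
move Es : (size us) => n; elim: n us x Es => [|n IH] us x Es gen x0.
  move/size0nil: Es => ->.
  rewrite /dasasm_identity /detsum_seq detsum_expand !big_nil big_ord0.
  rewrite big_ord0 add0r /normalization /cof /cofactor det_mx00 /=.
  by rewrite !expr0 !mulr1 divr1.
have points := identity_points IH.
case: us Es gen => // u us Es gen.
have [uniq_nodes nodes0] := interpolation_nodes gen.
set half := (u :: us) ++ _ in uniq_nodes nodes0.
set m := size (u :: us).
pose F y := topsum (u :: us) y all_up * \prod_(v <- u :: us) sigma (v * y^-1).
pose G y := normalization m * (\prod_(v <- u :: us) corner_factor v)
  * pairs (u :: us) * detsum_seq (u :: us) y.
have lF : laurent (2 * m) (4 * m) F.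
  have -> : (2 * m = m + m)%N by lia.
  have -> : (4 * m = m.*2 + m.*2)%N by lia.
  exact: laurentM (laurents_topsum (u :: us) all_up) (laurent_prod_sigma (u :: us)).
have lG : laurent (2 * m) (4 * m) G by apply/laurentZ/laurent_detsum.
have FG_root k y : k \in u :: us -> y ^+ 2 = k ^+ 2 -> F y = G y.
  move=> kus yk; have [_ u2 u3 _] := gen; have [k0 k1] := u2 _ kus.
  have y0 : y != 0.
    by apply: contra k0 => /eqP y0; rewrite -sqrf_eq0 -yk y0 expr0n.
  have -> : F y = 0.
    have sky : sigma (k * y^-1) = 0.
      rewrite /sigma; have -> : k * y^-1 - (k * y^-1)^-1 = (k ^+ 2 - y ^+ 2) / (k * y).
        by field; rewrite k0 y0.
      by rewrite yk subrr mul0r.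
    apply/eqP; rewrite /F mulf_eq0 prodf_seq_eq0; apply/orP; right.
    by apply/hasP; exists k; rewrite // sky eqxx.
  have lt_k : (index k (u :: us) < m)%N by rewrite index_mem.
  rewrite /G /detsum_seq -/m (detsum_root lt_k) ?mulr0 // ?nth_index ?yk //.
  by move=> j lt_j; apply: u3 => //; apply: mem_nth.
apply: (laurent_eq (F := F) (G := G) lF lG uniq_nodes) => //.
- apply/negP; rewrite in_cons (mem_cat 0 half) => /or3P [/eqP q2u|zh|/mapP [z zh /eqP]].
  + have [_ u2 _ _] := gen; have [u0 _] := u2 _ (mem_head _ _).
    have /eqP : (q ^+ 2 * u)^-1 = 0 by [].
    by rewrite invr_eq0 mulf_eq0 expf_eq0 (negbTE q0) (negbTE u0).
  + by rewrite zh in nodes0.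
  + by rewrite eq_sym oppr_eq0 => /eqP z0; rewrite -z0 zh in nodes0.
- have sh : size half = (m + m)%N by rewrite size_cat size_map.
  have -> : size ((q ^+ 2 * u)^-1 :: half ++ map -%R half) = (size half + size half).+1.
    by rewrite -[LHS]/(size (half ++ map -%R half)).+1 (size_cat half) size_map.
  by rewrite sh; lia.
move=> y; rewrite in_cons (mem_cat y half) => /or3P [/eqP ->||/mapP [z zh ->]].
(* After inversion the extra node becomes $q^2u=q^2/u^{-1}$, a recursion point for the inverted
   parameters. *)
- apply: identity_inv; rewrite invrK -[u in _ * u]invrK.
  apply: (points _ _ _ (generic_inv gen) _).1; first by rewrite size_map.
  exact: mem_head.
- rewrite mem_cat => /orP [yus|/mapP [k kus ->]]; first exact: FG_root yus erefl.
  exact: (points _ _ Es gen kus).1.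
move: zh; rewrite mem_cat => /orP [zus|/mapP [k kus ->]].
  by apply: FG_root zus _; rewrite sqrrN.
exact: (points _ _ Es gen kus).2.
Qed.

(** Genericity here includes the central parameter: it makes nonzero the denominators that
    [dasasm_identity] had cleared. *)
Lemma Z_generic n (u : nat -> K) :
  generic (map u (iota 1 n.+1)) ->
  Z n q u =
    sigma (q ^+ 2) ^+ n / (sigma q ^+ (2 * n) * sigma (q ^+ 4) ^+ (n ^ 2))
    * \prod_(1 <= i < n.+1)
        (sigma (u i) * sigma (q * u i) * sigma (q * (u i)^-1)
         * sigma (q ^+ 2 * u i * u n.+1)
         * sigma (q ^+ 2 * (u i)^-1 * (u n.+1)^-1)
         / sigma (u i * (u n.+1)^-1))
    * \prod_(1 <= i < n.+1) \prod_(i.+1 <= j < n.+1)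
        (sigma (q ^+ 2 * u i * u j) * sigma (q ^+ 2 * (u i)^-1 * (u j)^-1)
         / sigma (u i * (u j)^-1)) ^+ 2
    * (\det (matM n q u) + \det (matM' n q u)).
Proof.
move=> gen; set us := map u (iota 1 n); set x := u n.+1.
have {}gen : generic (x :: us).
  apply: generic_perm gen; rewrite -[n.+1]addn1 iotaD map_cat /= add1n.
  by rewrite perm_catC.
have [/= /andP [xus _] u2 u3 u4] := gen.
have [x0 x1] := u2 _ (mem_head _ _).
have sub i : (1 <= i < n.+1)%N -> u i \in x :: us.
  by move=> lt_i; rewrite inE map_f ?orbT // mem_iota.
have su i : (1 <= i < n.+1)%N -> sigma (u i * x^-1) != 0.
  move=> lt_i; have ux : u i != x.
    by apply: contraNneq xus => <-; apply: map_f; rewrite mem_iota.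
  have [ux2 _] := u4 _ _ (sub i lt_i) (mem_head _ _) ux.
  have [u0 _] := u2 _ (sub i lt_i).
  apply: sigma_neq0; first by rewrite mulf_neq0 ?invr_eq0.
  by rewrite expr_div_n; apply: contra ux2 => /eqP /divr1_eq ->.
have id := dasasm_identity_generic (generic_behead gen) x0.
have sz : size us = n by rewrite size_map size_iota.
have ELE : detsum_seq us x = (\prod_(1 <= i < n.+1) sigma2 (u i) x)
    * (\det (matM n q u) + \det (matM' n q u)).
  rewrite matM'_inv !det_matM.
  have -> : detsum_seq us x = detsum n (fun i => u i.+1) x.
    rewrite /detsum_seq sz; apply: detsum_sign => i lt_i; left.
    by rewrite (nth_map 0%N) ?size_iota // nth_iota.
  rewrite (detsum_detN (w := fun i => u i.+1)) //= => [|j lt_j].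
    by rewrite big_add1 big_mkord.
  by apply: u3; [apply: sub | apply: mem_head].
rewrite Z_topsum -/us -/x.
have prodE (G : K -> K) : \prod_(v <- us) G v = \prod_(1 <= i < n.+1) G (u i).
  by rewrite big_map /index_iota subn1.
have P0 : \prod_(1 <= i < n.+1) sigma (u i * x^-1) != 0.
  rewrite prodf_seq_neq0; apply/allP => i; rewrite mem_index_iota; exact: su.
apply: (mulIf P0); rewrite -(prodE (fun v => sigma (v * x^-1))) id.
have := @prod_pairs u n 1 isT; rewrite subn1 /= -/us => ->.
rewrite sz ELE !prodE /normalization /corner_factor /pair_weight /sigma2.
rewrite !big_split /= prodfV.
move: P0; set P := \prod_(1 <= i < n.+1) sigma (u i / x) => P0.
by set c := _ / (_ * _); field.
Qed.

End Interpolation.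

End Partition.

(** * Genericity of the indeterminates *)

Section Ratfun.
Variables (F : fieldType) (charF : [pchar F] =i pred0) (n : nat).

Lemma natr_neq (a b : nat) : a != b -> a%:R != b%:R :> F.
Proof.
have nat0 : forall m, (m%:R == 0 :> F) = (m == 0)%N by apply/pcharf0P.
wlog le_ab : a b / (a <= b)%N => [H|].
  by case/orP: (leq_total a b) => /H // Hba; rewrite eq_sym => /Hba; rewrite eq_sym.
move=> ab; rewrite -(subnKC le_ab) natrD -subr_eq0 opprD addrA subrr sub0r oppr_eq0.
by rewrite nat0 subn_eq0 -ltnNge ltn_neqAle ab.
Qed.

(** Setting one variable to 2 and all others to 1 turns monomials into powers of 2, which
    characteristic 0 keeps distinct. *)
Lemma tofrac_neq (k : 'I_n.+2) (p r : {mpoly F[n.+2]}) (a b : nat) : a != b ->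
  p.@[fun i => (if i == k then 2 else 1)%N%:R] = a%:R ->
  r.@[fun i => (if i == k then 2 else 1)%N%:R] = b%:R ->
  tofrac p != tofrac r.
Proof.
move=> /natr_neq ab pa rb; apply: contra ab; rewrite tofrac_eq => /eqP pr.
by rewrite -pa -rb pr.
Qed.

Notation q := (qvar F n).
Notation u := (uvar F n).

Lemma inord_neq0 i : (1 <= i <= n.+1)%N -> (inord i == ord0 :> 'I_n.+2) = false.
Proof. by case/andP=> i0 le_i; rewrite -val_eqE /= inordK ?gtn_eqF. Qed.

Lemma generic_vars : generic q (map u (iota 1 n.+1)).
Proof.
have uP v : v \in map u (iota 1 n.+1) -> exists2 i, (1 <= i <= n.+1)%N & v = u i.
  by case/mapP => i; rewrite mem_iota => lt_i ->; exists i => //; lia.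
have u_neq i j : (1 <= i <= n.+1)%N -> (1 <= j <= n.+1)%N -> i != j ->
    u i ^+ 2 != u j ^+ 2.
  move=> iP jP ij; rewrite -!rmorphXn; apply: (@tofrac_neq (inord i) _ _ 4 1) => [//||].
    by rewrite rmorphXn /= mevalXU eqxx -natrX.
  rewrite rmorphXn /= mevalXU -val_eqE /= !inordK; try lia.
  by rewrite eq_sym (negbTE ij) expr1n.
apply: generic_monomials.
- rewrite -tofrac0; apply: (@tofrac_neq ord0 _ _ 2 0) => [//||].
    by rewrite mevalXU eqxx.
  by rewrite meval0.
- rewrite map_inj_in_uniq ?iota_uniq // => i j; rewrite !mem_iota => iP jP uij.
  apply/eqP; apply: contraT => ij.
  by have /eqP [] := u_neq i j iP jP ij; rewrite uij.
- move=> _ /uP [i iP ->]; split.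
    rewrite -tofrac0; apply: (@tofrac_neq (inord i) _ _ 2 0) => [//||].
      by rewrite mevalXU eqxx.
    by rewrite meval0.
  rewrite -tofrac1 -rmorphXn; apply: (@tofrac_neq (inord i) _ _ 4 1) => [//||].
    by rewrite rmorphXn /= mevalXU eqxx -natrX.
  by rewrite meval1.
- move=> _ _ /uP [i iP ->] /uP [j jP ->]; split.
    rewrite -tofrac1 -rmorphXn -rmorphM -rmorphM -rmorphXn.
    apply: (@tofrac_neq ord0 _ _ 16 1) => [//||]; last by rewrite meval1.
    by rewrite !(rmorphXn, rmorphM) /= !mevalXU eqxx !inord_neq0 // !mulr1 -!natrX.
  rewrite -rmorphXn -rmorphM -rmorphXn; apply: (@tofrac_neq ord0 _ _ 16 1) => [//||].
    by rewrite rmorphXn /= mevalXU eqxx -natrX.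
  by rewrite !(rmorphXn, rmorphM) /= !mevalXU !inord_neq0 // mulr1 expr1n.
move=> _ _ /uP [i iP ->] /uP [j jP ->] uij; split.
  apply: (u_neq i j iP jP); apply: contraNneq uij => ->; exact: eqxx.
rewrite -rmorphXn -rmorphM -!rmorphXn; apply: (@tofrac_neq ord0 _ _ 256 1) => [//||].
  by rewrite !(rmorphXn, rmorphM) /= !mevalXU eqxx !inord_neq0 // !mulr1 -!natrX.
by rewrite rmorphXn /= mevalXU inord_neq0 // expr1n.
Qed.

End Ratfun.

Theorem theorem1 (F : fieldType) (charF : [pchar F] =i pred0) (n : nat) :
  let q : ratfun F n := qvar F n in
  let u : nat -> ratfun F n := uvar F n in
  Z n q u =
    sigma (q ^+ 2) ^+ n / (sigma q ^+ (2 * n) * sigma (q ^+ 4) ^+ (n ^ 2))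
    * \prod_(1 <= i < n.+1)
        (sigma (u i) * sigma (q * u i) * sigma (q * (u i)^-1)
         * sigma (q ^+ 2 * u i * u n.+1)
         * sigma (q ^+ 2 * (u i)^-1 * (u n.+1)^-1)
         / sigma (u i * (u n.+1)^-1))
    * \prod_(1 <= i < n.+1) \prod_(i.+1 <= j < n.+1)
        (sigma (q ^+ 2 * u i * u j) * sigma (q ^+ 2 * (u i)^-1 * (u j)^-1)
         / sigma (u i * (u j)^-1)) ^+ 2
    * (\det (matM n q u) + \det (matM' n q u)).
Proof.
move=> q u.
have q_pow k : (0 < k)%N -> q ^+ k != 1.
  move=> k0; rewrite -tofrac1 -rmorphXn.
  apply: (@tofrac_neq F charF n ord0 _ _ (2 ^ k) 1).
  - by rewrite -[1%N](expn0 2) eqn_exp2l // -lt0n.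
  - by rewrite rmorphXn /= mevalXU eqxx -natrX.
  - by rewrite meval1.
have q0 : q != 0.
  rewrite -tofrac0; apply: (@tofrac_neq F charF n ord0 _ _ 2 0) => [//||].
    by rewrite mevalXU eqxx.
  by rewrite meval0.
have two0 : (2 : ratfun F n) != 0.
  rewrite -tofrac0 -(rmorph_nat (@FracField.tofrac _) 2).
  apply: (@tofrac_neq F charF n ord0 _ _ 2 0) => [//||]; first by rewrite rmorph_nat.
  by rewrite meval0.
have sq1 : sigma q != 0 by apply: sigma_neq0 q0 (q_pow 2 isT).
have sq4 : sigma (q ^+ 4) != 0.
  by apply: (sigma_neq0 (expf_neq0 4 q0)); rewrite -exprM; apply: q_pow.
exact: (Z_generic q0 sq1 sq4 two0 (n := n) (u := u) (generic_vars charF n)).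
Qed.
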